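(* Let $G$ be a (finitely generated) virtually abelian group with set of generators $X=\Sigma\cup T$, where $\Sigma$ is a symmetric set of generators for a finite index free abelian subgroup of $G$, and $T$ is a finite transversal for this subgroup. The following have an $n$-regular natural normal form (for some $n$) when viewed as tuples of words, and therefore project to EDT0L languages, with respect to $X$: (1) rational sets, (2) subgroups, (3) coset representatives of a fixed subgroup, (4) algebraic sets, (5) definable sets, (6) conjugacy representatives.
   Context: Natural normal form. The finite index free abelian subgroup is taken to be normal and is written $\mathbb Z^k$; $\Sigma=\{a_1,A_1,\dots,a_k,A_k\}$ consists of the standard generators $a_i$ of $\mathbb Z^k$ and their inverses $A_i=a_i^{-1}$, and $T=\{t_1,\dots,t_d\}$. The natural normal form of $G$ consists of the words $wt$ with $w$ a word over $\Sigma$ representing an element of $\mathbb Z^k$ and $t\in T$, namely $\mathrm{NF}(G)=\mathrm{NF}(\mathbb Z^k)T$, where $\mathrm{NF}(\mathbb Z^k)=(a_1^*\cup A_1^* )(a_2^*\cup A_2^* )\cdots(a_k^*\cup A_k^* )$. For $U\subseteq G$, the natural normal form of $U$ is $\mathrm{NF}(U)$, the set of words in $\mathrm{NF}(G)$ representing elements of $U$. Viewing normal forms as tuples means separating the successive factors of the word into coordinates: a word $w_1w_2\cdots w_k\in\mathrm{NF}(\mathbb Z^k)$ with $w_i\in a_i^*\cup A_i^*$ becomes the tuple $(w_1,\dots,w_k)$, and the transversal letter is kept as a further factor. The projection is the map $(w_1,\dots,w_n)\mapsto w_1w_2\cdots w_n$ that forgets the tuple structure. A set of $q$-tuples of elements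 of $G$ is regarded as a subset of the direct product $G^q$, which is again virtually abelian (with free abelian subgroup $\mathbb Z^{kq}$ and transversal given by products of elements of the $q$ copies of $T$); its natural normal form is taken in $\mathrm{NF}(G^q)$, the set of words consisting of the natural normal form of an element of $\mathbb Z^{kq}$ followed by an element of this transversal. Rational sets. A subset $R$ of a group with finite generating set $S$ is rational if it is the image of a regular language $L\subseteq S^*$ under the natural projection from words to group elements. Coset and conjugacy representatives. In (3) and (6) the set meant is a suitably chosen set containing exactly one element of each coset of the fixed subgroup, respectively exactly one element of each conjugacy class of $G$; the assertion is that such a set of representatives can be chosen with the stated property. Algebraic and definable sets. An algebraic set over $G$ is the solution set of a system of equations with coefficients in $G$. A set $V\subseteq G^q$ is definable if there are a first-order formula $\Phi(x_1,\dots,x_q,y_1,\dots,y_p)$ and parameters $m_1,\dots,m_p\in G$ such that $(g_1,\dots,g_q)\in V$ if and only if $\Phi(g_1,\dots,g_q,m_1,\dots,m_p)$ is true in $G$. $n$-regular languages. An asynchronous $n$-variable finite state automaton over a finite alphabet $A$ is a finite directed graph with edges labelled by elements of $(A\cup\{\varepsilon\})^n$ having at most one non-$\varepsilon$ entry ($\varepsilon$ is the empty word), with a start vertex and a set of accept vertices. It accepts $\mathbf w\in(A^* )^n$ if $\mathbf w$ is obtained by concatenating coordinatewise the labels along a directed path from the start vertex to an accept vertex and deleting all $\varepsilon$'s. A subset of $(A^* )^n$ is $n$-regular if it is the set of tuples accepted by such an automaton. EDT0L languages. A language $L\subseteq A^*$ is EDT0L if there are a finite alphabet $C\supseteq A$,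 a word $w_0\in C^*$ and a rational subset $\mathcal R$ of the monoid $\mathrm{End}(C^* )$ (the image of a regular language over some finite set $B\subset\mathrm{End}(C^* )$) with $L=\{\phi(w_0):\phi\in\mathcal R\}\cap A^*$. *)

(* Defs.v *)
From HB Require Import structures.
From mathcomp Require Import all_boot.
From mathcomp Require Import ssrint.
From mathcomp Require Import boolp classical_sets.

Set Implicit Arguments.
Unset Strict Implicit.
Unset Printing Implicit Defensive.

Local Open Scope classical_set_scope.
Local Open Scope group_scope.

Record dfa (A : finType) := Dfa {
  dfa_state : finType;
  dfa_start : dfa_state;
  dfa_next : dfa_state -> A -> dfa_state;
  dfa_final : {set dfa_state} }.

Definition regular (A : finType) (L : set (seq A)) : Prop :=
  exists M : dfa A,
    L = [set w | foldl (@dfa_next A M) (dfa_start M) w \in dfa_final M].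

(* An edge is (source, label, target); [None] stands for the empty word. *)
Definition async_edge (n : nat) (A V : finType) : finType :=
  (V * {ffun 'I_n -> option A} * V)%type.

Record async_automaton (n : nat) (A : finType) := AsyncAutomaton {
  vertex : finType;
  edges : {set async_edge n A vertex};
  edges_label : forall e, e \in edges -> #|[pred i | e.1.2 i != None]| <= 1;
  start : vertex;
  accept : {set vertex} }.

Fixpoint accepting_path (n : nat) (A : finType) (M : async_automaton n A)
    (v : vertex M) (p : seq (async_edge n A (vertex M))) : bool :=
  if p is e :: p' then [&& e \in edges M, e.1.1 == v & accepting_path e.2 p']
  else v \in accept M.

Definition accepts (n : nat) (A : finType) (M : async_automaton n A)
    (u : n.-tuple (seq A)) : Prop :=
  exists p : seq (async_edge n A (vertex M)),
    accepting_path (start M) p /\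
    forall i, tnth u i = pmap (fun e : async_edge n A (vertex M) => e.1.2 i) p.

Definition n_regular (n : nat) (A : finType) (L : set (n.-tuple (seq A))) :
    Prop :=
  exists M : async_automaton n A, L = [set u | accepts M u].

(* The free monoid endomorphism of [seq C] extending [f]. *)
Definition free_endo (C : Type) (f : C -> seq C) (w : seq C) : seq C :=
  flatten [seq f c | c <- w].

(* [B] indexes a finite set of endomorphisms of [seq C]; the word b_1 ... b_m
   over [B] is sent to the composite h_(b_1) \o ... \o h_(b_m).  The inclusion
   of [A] into [C] is the injection [inc]. *)
Definition EDT0L (A : finType) (L : set (seq A)) : Prop :=
  exists (C : finType) (inc : A -> C) (w0 : seq C)
         (B : finType) (h : B -> C -> seq C) (R : set (seq B)),
    [/\ injective inc, regular R &
        L = [set w | exists2 r, R r &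
               map inc w = foldr (fun b => free_endo (h b)) w0 r]].

Definition is_subgroup (G : groupType) (H : set G) : Prop :=
  [/\ H 1, forall x y, H x -> H y -> H (x * y) & forall x, H x -> H x^-1].

Definition generated (G : groupType) (A : set G) : set G :=
  [set g | forall H : set G, is_subgroup H -> A `<=` H -> H g].

Definition zexpg (G : groupType) (x : G) (z : int) : G :=
  match z with Posz n => x ^+ n | Negz n => x ^- n.+1 end.

Definition free_abelian_basis (G : groupType) (k : nat) (a : 'I_k -> G) :
    Prop :=
  (forall i j, commute (a i) (a j)) /\
  (forall e : 'I_k -> int,
     \prod_(i < k) zexpg (a i) (e i) = 1 -> forall i, e i = Posz 0).

(* [a] is a basis of a normal free abelian subgroup Z^k of [G], and [t] is a
   transversal of this subgroup; its index is finite since [J] is. *)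
Definition natural_generators (G : groupType) (k : nat) (a : 'I_k -> G)
    (J : finType) (t : J -> G) : Prop :=
  [/\ free_abelian_basis a,
      forall h g, generated (range a) h -> generated (range a) (h ^ g) &
      forall g, exists! j, generated (range a) (g * (t j)^-1)].

(* Formal letters: [inl (i, false)] is a_i, [inl (i, true)] is its inverse A_i,
   and [inr j] is the transversal letter t_j. *)
Definition letter (k : nat) (J : finType) : finType :=
  ('I_k * bool + J)%type.

Definition letter_val (G : groupType) (k : nat) (a : 'I_k -> G)
    (J : finType) (t : J -> G) (x : letter k J) : G :=
  match x with
  | inl (i, b) => if b then (a i)^-1 else a i
  | inr j => t j
  end.

Definition word_val (A : Type) (G : groupType) (v : A -> G) (w : seq A) : G :=
  \prod_(x <- w) v x.

Definition proj_words (n : nat) (A : Type) (u : n.-tuple (seq A)) : seq A :=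
  flatten u.

(* The tuples (w_1, ..., w_k, t) with w_i in a_i^* \cup A_i^* and t in T. *)
Definition NF_tuple (k : nat) (J : finType) :
    set (k.+1.-tuple (seq (letter k J))) :=
  [set u |
    (forall i : 'I_k, exists (b : bool) (m : nat),
       tnth u (widen_ord (leqnSn k) i) = nseq m (inl (i, b))) /\
    (exists j : J, tnth u ord_max = [:: inr j])].

Definition NF_of (G : groupType) (k : nat) (a : 'I_k -> G)
    (J : finType) (t : J -> G) (U : set G) :
    set (k.+1.-tuple (seq (letter k J))) :=
  [set u | NF_tuple u /\ U (word_val (letter_val a t) (proj_words u))].

Definition n_regular_EDT0L_NF (G : groupType) (k : nat) (a : 'I_k -> G)
    (J : finType) (t : J -> G) (U : set G) : Prop :=
  n_regular (NF_of a t U) /\ EDT0L (@proj_words _ _ @` NF_of a t U).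

(* The generators of Z^(kq) in G^q, ordered by copy first: i = c * k + j stands
   for a_j in the copy c. *)
Definition pow_index (q k : nat) (i : 'I_(q * k)) : 'I_q * 'I_k :=
  enum_val (cast_ord (esym (etrans (card_prod _ _)
                              (congr2 muln (card_ord q) (card_ord k)))) i).

Definition pow_basis (G : groupType) (q k : nat) (a : 'I_k -> G)
    (i : 'I_(q * k)) : {ffun 'I_q -> G} :=
  [ffun c => if c == (pow_index i).1 then a (pow_index i).2 else 1].

Definition pow_transversal (G : groupType) (q : nat) (J : finType)
    (t : J -> G) (f : {ffun 'I_q -> J}) : {ffun 'I_q -> G} :=
  [ffun c => t (f c)].

Definition rational (G : groupType) (S : finType) (s : S -> G) (U : set G) :
    Prop :=
  exists2 L : set (seq S), regular L & U = word_val s @` L.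

Definition right_coset_reps (G : groupType) (H R : set G) : Prop :=
  forall g, exists! r, R r /\ H (r * g^-1).

Definition left_coset_reps (G : groupType) (H R : set G) : Prop :=
  forall g, exists! r, R r /\ H (g^-1 * r).

Definition conjugacy_reps (G : groupType) (R : set G) : Prop :=
  forall g, exists! r, R r /\ exists h, r = g ^ h.

(* An equation is w = 1, where the letters of w are variables
   ([inl (i, false)]), inverses of variables ([inl (i, true)]) and coefficients
   in [G]. *)
Definition equation (G : groupType) (q : nat) : Type :=
  seq ('I_q * bool + G).

Definition solves (G : groupType) (q : nat) (g : {ffun 'I_q -> G})
    (w : equation G q) : Prop :=
  word_val (fun x : 'I_q * bool + G =>
    match x with
    | inl (i, b) => if b then (g i)^-1 else g i
    | inr c => c
    end) w = 1.

(* Systems are not required to be finite. *)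
Definition algebraic (G : groupType) (q : nat) (V : set {ffun 'I_q -> G}) :
    Prop :=
  exists E : set (equation G q), V = [set g | forall w, E w -> solves g w].

(* First-order logic in the language of groups, with well-scoped de Bruijn
   variables: quantifiers bind the variable [ord0]. *)
Inductive gterm (n : nat) : Type :=
| TVar of 'I_n
| TOne
| TMul of gterm n & gterm n
| TInv of gterm n.

Inductive gformula : nat -> Type :=
| FEq n of gterm n & gterm n : gformula n
| FNot n of gformula n : gformula n
| FAnd n of gformula n & gformula n : gformula n
| FOr n of gformula n & gformula n : gformula n
| FImpl n of gformula n & gformula n : gformula n
| FForall n of gformula n.+1 : gformula n
| FExists n of gformula n.+1 : gformula n.

Fixpoint teval (G : groupType) (n : nat) (e : 'I_n -> G) (u : gterm n) : G :=
  match u with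
  | TVar i => e i
  | TOne => 1
  | TMul u1 u2 => teval e u1 * teval e u2
  | TInv u1 => (teval e u1)^-1
  end.

Definition env_cons (X : Type) (n : nat) (x : X) (e : 'I_n -> X)
    (i : 'I_n.+1) : X :=
  if unlift ord0 i is Some j then e j else x.

Definition env_cat (X : Type) (q p : nat) (e : 'I_q -> X) (f : 'I_p -> X)
    (i : 'I_(q + p)) : X :=
  match split i with inl j => e j | inr j => f j end.

Fixpoint holds (G : groupType) (n : nat) (F : gformula n) :
    ('I_n -> G) -> Prop :=
  match F in gformula n return ('I_n -> G) -> Prop with
  | FEq _ u v => fun e => teval e u = teval e v
  | FNot _ F1 => fun e => ~ holds F1 e
  | FAnd _ F1 F2 => fun e => holds F1 e /\ holds F2 e
  | FOr _ F1 F2 => fun e => holds F1 e \/ holds F2 e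
  | FImpl _ F1 F2 => fun e => holds F1 e -> holds F2 e
  | FForall _ F1 => fun e => forall x, holds F1 (env_cons x e)
  | FExists _ F1 => fun e => exists x, holds F1 (env_cons x e)
  end.

Definition definable (G : groupType) (q : nat) (V : set {ffun 'I_q -> G}) :
    Prop :=
  exists (p : nat) (F : gformula (q + p)) (m : 'I_p -> G),
    V = [set g | holds F (env_cat g m)].

(* Main.v *)
Require Import Defs.
From HB Require Import structures.
From mathcomp Require Import all_boot all_order all_algebra.
From mathcomp Require Import zify.
From mathcomp Require Import boolp classical_sets.

(** Every element of G is a^z t_j for a unique vector z of Z^k and a unique
    coset index j, and z determines its normal form.  A set is handled through
    the sets of vectors z it cuts out on the cosets, which turn out to be
    definable in Presburger arithmetic.  Multiplication and inversion act on
    the vectors by affine maps (conjugation acts linearly on Z^k), so every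
    first-order formula over G translates into Presburger arithmetic, where
    quantifiers are eliminated by Cooper's method.  Subgroups and algebraic sets
    cut out translates of subgroups of Z^k, which are finitely generated; a
    rational set cuts out the label sums of the accepted paths of a finite graph
    with labels in Z^k, a semilinear set by Kleene's state elimination; sets of
    representatives are obtained by definable minimisation in each class.
    Conversely, Dickson's lemma splits a quantifier-free definable set into
    finitely many sets b + N p_1 + ... + N p_m, each contained in one orthant,
    and such a set of normal forms is produced by an asynchronous automaton that
    emits b and then loops through the periods p_i.  Finally the runs of an
    asynchronous automaton are simulated by an EDT0L system with one nonterminal
    for each coordinate and vertex. *)

Set Implicit Arguments.
Unset Strict Implicit.
Unset Printing Implicit Defensive.

Import Order.TTheory GRing.Theory Num.Theory.
Local Open Scope ring_scope.

(** * Presburger definable sets and quantifier elimination *)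

Definition affine_form (X : finType) : Type := ({ffun X -> int} * int)%type.

Definition aff_eval (X : finType) (l : affine_form X) (e : {ffun X -> int}) :
    int :=
  \sum_x l.1 x * e x + l.2.

Definition affine (X : finType) (f : {ffun X -> int} -> int) : Prop :=
  exists l, forall e, f e = aff_eval l e.

Definition update (X : finType) (e : {ffun X -> int}) (x : X) (v : int) :
    {ffun X -> int} :=
  [ffun y => if y == x then v else e y].

Section Affine.
Variable X : finType.
Implicit Types f g : {ffun X -> int} -> int.

Lemma affine_const d : affine (fun _ : {ffun X -> int} => d).
Proof.
exists ([ffun=> 0], d) => e; rewrite /aff_eval big1 ?add0r // => x _.
by rewrite ffunE mul0r.
Qed.

Lemma affine_add f g : affine f -> affine g -> affine (fun e => f e + g e).
Proof.
move=> [l hf] [m hg]; exists ([ffun x => l.1 x + m.1 x], l.2 + m.2) => e.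
rewrite hf hg /aff_eval addrACA -big_split /=; congr (_ + _).
by apply: eq_bigr => x _; rewrite ffunE mulrDl.
Qed.

Lemma affine_scale c f : affine f -> affine (fun e => c * f e).
Proof.
move=> [l hf]; exists ([ffun x => c * l.1 x], c * l.2) => e.
rewrite hf /aff_eval mulrDr mulr_sumr; congr (_ + _).
by apply: eq_bigr => x _; rewrite ffunE mulrA.
Qed.

Lemma affine_ext f g : f =1 g -> affine f -> affine g.
Proof. by move=> fg [l hf]; exists l => e; rewrite -fg. Qed.

Lemma affine_opp f : affine f -> affine (fun e => - f e).
Proof.
by move/(affine_scale (-1)); apply: affine_ext => e; rewrite mulN1r.
Qed.

Lemma affine_sub f g : affine f -> affine g -> affine (fun e => f e - g e).
Proof. by move=> hf /affine_opp; apply: affine_add. Qed.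

Lemma affine_sum (I : Type) (r : seq I) (F : I -> {ffun X -> int} -> int) :
  (forall i, affine (F i)) -> affine (fun e => \sum_(i <- r) F i e).
Proof.
move=> hF; elim: r => [|i r IH].
  by apply: affine_ext (affine_const 0) => e; rewrite big_nil.
by apply: affine_ext (affine_add (hF i) IH) => e; rewrite big_cons.
Qed.

Lemma affine_var x : affine (fun e : {ffun X -> int} => e x).
Proof.
exists ([ffun y => (y == x)%:R], 0) => e.
rewrite /aff_eval addr0 (bigD1 x) //= ffunE eqxx mul1r big1 ?addr0 // => y.
by rewrite ffunE => /negPf->; rewrite mul0r.
Qed.

Lemma affine_aff_eval l : affine (@aff_eval X l).
Proof. by exists l. Qed.

Lemma affine_comp (Y : finType) (f : {ffun Y -> int} -> int)
    (h : {ffun X -> int} -> {ffun Y -> int}) :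
  affine f -> (forall y, affine (fun e => h e y)) -> affine (fun e => f (h e)).
Proof.
move=> [l hf] hh.
apply: (@affine_ext (fun e => \sum_y l.1 y * h e y + l.2)) => [e|].
  by rewrite hf.
apply: affine_add (affine_const _); apply: affine_sum => y.
exact: affine_scale.
Qed.

Lemma affine_update f x :
  affine f -> exists c g, affine g /\ forall e v, f (update e x v) = c * v + g e.
Proof.
move=> hf; have [l fE] := hf; exists (l.1 x), (fun e => f (update e x 0)).
split.
  apply: affine_comp hf _ => y.
  have [->|ne] := eqVneq y x.
    by apply: affine_ext (affine_const 0) => e; rewrite ffunE eqxx.
  by apply: affine_ext (affine_var y) => e; rewrite ffunE (negPf ne).
move=> e v; rewrite !fE /aff_eval (bigD1 x) //= [in RHS](bigD1 x) //= !ffunE eqxx.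
rewrite mulr0 add0r.
rewrite addrA; congr (_ + _ + _); apply: eq_bigr => y /negPf ne.
by rewrite !ffunE ne.
Qed.

End Affine.

(** Quantifier-free Presburger predicates are described semantically: [qf_ext] closes the class
    under pointwise equivalence, which replaces a syntax of formulas. *)
Inductive qf (X : finType) : ({ffun X -> int} -> Prop) -> Prop :=
| qf_ge f : affine f -> qf (fun e => 0 <= f e)
| qf_dvd (m : int) f : 0 < m -> affine f -> qf (fun e => (m %| f e)%Z)
| qf_not P : qf P -> qf (fun e => ~ P e)
| qf_and P Q : qf P -> qf Q -> qf (fun e => P e /\ Q e)
| qf_ext P Q : (forall e, P e <-> Q e) -> qf P -> qf Q.

Section Qf.
Variable X : finType.
Implicit Types P Q : {ffun X -> int} -> Prop.
Implicit Types f g : {ffun X -> int} -> int.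

(** Classically a proposition independent of [e] is true or false, so side conditions on cosets or
    automaton states may be mixed into [qf] predicates. *)
Lemma qf_const (p : Prop) : qf (fun _ : {ffun X -> int} => p).
Proof.
have hT : qf (fun _ : {ffun X -> int} => 0 <= 0 :> int).
  exact/qf_ge/affine_const.
have [hp|hp] := pselect p; first by apply: qf_ext hT => e; split.
by apply: qf_ext (qf_not hT) => e; split.
Qed.

Lemma qf_or P Q : qf P -> qf Q -> qf (fun e => P e \/ Q e).
Proof.
move=> hP hQ; apply: qf_ext (qf_not (qf_and (qf_not hP) (qf_not hQ))) => e.
by rewrite -not_orE notK.
Qed.

Lemma qf_imp P Q : qf P -> qf Q -> qf (fun e => P e -> Q e).
Proof.
move=> hP hQ; apply: qf_ext (qf_or (qf_not hP) hQ) => e.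
by rewrite implyE.
Qed.

Lemma qf_ex_seq (I : eqType) (s : seq I) (P : I -> {ffun X -> int} -> Prop) :
  (forall i, i \in s -> qf (P i)) -> qf (fun e => exists2 i, i \in s & P i e).
Proof.
elim: s => [|i s IH] hP.
  by apply: qf_ext (qf_const False) => e; split=> // -[].
have hi : qf (P i) by apply: hP; rewrite mem_head.
have /IH hs : forall j, j \in s -> qf (P j).
  by move=> j js; apply: hP; rewrite inE js orbT.
apply: qf_ext (qf_or hi hs) => e; split.
  by case=> [h|[j js h]]; [exists i | exists j] => //; rewrite inE ?eqxx ?js ?orbT.
by case=> j; rewrite inE => /orP[/eqP->|js] h; [left | right; exists j].
Qed.

Lemma qf_ex_fin (I : finType) (P : I -> {ffun X -> int} -> Prop) :
  (forall i, qf (P i)) -> qf (fun e => exists i, P i e).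
Proof.
move=> hP; apply: qf_ext (@qf_ex_seq _ (enum I) P _) => // e.
by split=> -[i]; [exists i | exists i; rewrite ?mem_enum].
Qed.

Lemma qf_all_fin (I : finType) (P : I -> {ffun X -> int} -> Prop) :
  (forall i, qf (P i)) -> qf (fun e => forall i, P i e).
Proof.
move=> hP; apply: qf_ext (qf_not (qf_ex_fin (fun i => qf_not (hP i)))) => e.
by rewrite -forallNE; split=> h i; [apply: contrapT | move/(_ (h i))].
Qed.

Lemma qf_le f g : affine f -> affine g -> qf (fun e => f e <= g e).
Proof.
move=> hf hg; apply: qf_ext (qf_ge (affine_sub hg hf)) => e.
by rewrite subr_ge0.
Qed.

Lemma qf_eq f g : affine f -> affine g -> qf (fun e => f e = g e).
Proof.
move=> hf hg; apply: qf_ext (qf_and (qf_le hf hg) (qf_le hg hf)) => e.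
by split=> [[h1 h2]|->] //; apply/eqP; rewrite eq_le h1 h2.
Qed.

Lemma qf_comp (Y : finType) (P : {ffun Y -> int} -> Prop)
    (h : {ffun X -> int} -> {ffun Y -> int}) :
  (forall y, affine (fun e => h e y)) -> qf P -> qf (fun e => P (h e)).
Proof.
move=> hh; elim=> [f hf|m f hm hf|Q _ IH|Q R _ IHQ _ IHR|Q R QR _ IH].
- exact/qf_ge/affine_comp.
- exact/qf_dvd/affine_comp.
- exact: qf_not.
- exact: qf_and.
- by apply: qf_ext IH => e.
Qed.

(** This is the substitution step of Cooper's method. Scaling an atom by [c > 0] turns [c * v] into
    [f e], and [c %| f e] expresses that [v] exists. Since [v] is unique, the quantifier commutes
    with negation and conjunction. *)
Lemma qf_solve P x c f : 0 < c -> affine f -> qf P ->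
  qf (fun e => exists2 v, c * v = f e & P (update e x v)).
Proof.
move=> c0 hf.
have hc : qf (fun e => (c %| f e)%Z) by apply: qf_dvd.
have inj v w : c * v = c * w -> v = w by apply: mulfI; rewrite gt_eqF.
elim=> [g hg|m g hm hg|Q _ IH|Q R _ IHQ _ IHR|Q R QR _ IH].
- have [a [g' [hg' gE]]] := affine_update x hg.
  have h : affine (fun e => a * f e + c * g' e).
    by apply: affine_add; apply: affine_scale.
  apply: qf_ext (qf_and hc (qf_ge h)) => e; split.
    case=> /dvdzP[v fv] h0; exists v; first by rewrite mulrC.
    by rewrite gE -(pmulr_rge0 _ c0) mulrDr mulrCA [c * v]mulrC -fv.
  case=> v fv h0; split; first by rewrite -fv dvdz_mulr.
  by rewrite -fv mulrCA -mulrDr pmulr_rge0 // -gE.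
- have [a [g' [hg' gE]]] := affine_update x hg.
  have h : affine (fun e => a * f e + c * g' e).
    by apply: affine_add; apply: affine_scale.
  have hcm : 0 < c * m by apply: mulr_gt0.
  apply: qf_ext (qf_and hc (qf_dvd hcm h)) => e; split.
    case=> /dvdzP[v fv] h0; exists v; first by rewrite mulrC.
    move: h0; rewrite fv [v * c]mulrC mulrCA -mulrDr -gE.
    by rewrite dvdz_mul2l // gt_eqF.
  case=> v fv h0; split; first by rewrite -fv dvdz_mulr.
  by rewrite -fv mulrCA -mulrDr dvdz_mul2l ?gt_eqF // -gE.
- apply: qf_ext (qf_and hc (qf_not IH)) => e; split.
    case=> /dvdzP[v fv] h0; exists v; first by rewrite mulrC.
    by move=> hQ; apply: h0; exists v => //; rewrite mulrC.
  case=> v fv h0; split; first by rewrite -fv dvdz_mulr.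
  by case=> w; rewrite -fv => /inj->.
- apply: qf_ext (qf_and IHQ IHR) => e; split.
    by case=> -[v fv hQ] [w]; rewrite -fv => /inj-> hR; exists v.
  by case=> v fv [hQ hR]; split; exists v.
- by apply: qf_ext IH => e; split=> -[v fv /QR]; exists v.
Qed.

(** For [b.1 > 0], the pair [b] stands for the threshold [aff_eval b.2 e / b.1], and crossing means
    that it lies in the half-open interval from [v - delta] (excluded) to [v] (included). *)
Definition crosses (e : {ffun X -> int}) (v delta : int)
    (b : int * affine_form X) : bool :=
  b.1 * (v - delta) < aff_eval b.2 e <= b.1 * v.

Definition periodic_off P (x : X) (delta : int)
    (bs : seq (int * affine_form X)) : Prop :=
  forall e v, ~~ has (crosses e v delta) bs ->
    (P (update e x v) <-> P (update e x (v - delta))).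

(** A stretch of length [delta * n] that meets no boundary is made of [n] stretches of length
    [delta] that meet none. *)
Lemma periodic_offM P x (delta : int) (bs : seq (int * affine_form X)) (n : nat) :
  0 < delta -> all (fun b => 0 < b.1) bs ->
  periodic_off P x delta bs -> periodic_off P x (delta * n%:Z) bs.
Proof.
move=> d0 pos per e v; elim: n => [|n IH]; first by rewrite mulr0 subr0.
move=> h.
have h1 : ~~ has (crosses e v (delta * n%:Z)) bs.
  apply: contra h => /hasP[b bb /andP[h1 h2]]; apply/hasP; exists b => //.
  apply/andP; split=> //; apply: le_lt_trans h1.
  by rewrite ler_pM2l ?(allP pos) //; nia.
have h2 : ~~ has (crosses e (v - delta * n%:Z) delta) bs.
  apply: contra h => /hasP[b bb /andP[h3 h4]]; apply/hasP; exists b => //.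
  rewrite /crosses.
  have -> : v - delta * n.+1%:Z = v - delta * n%:Z - delta by lia.
  apply/andP; split=> //; apply: le_trans h4 _.
  by rewrite ler_pM2l ?(allP pos) //; nia.
apply: iff_trans (IH h1) _.
have -> : v - delta * n.+1%:Z = v - delta * n%:Z - delta by lia.
exact: per.
Qed.

Lemma qf_periodic P x : qf P ->
  exists (delta : int) (bs : seq (int * affine_form X)), [/\ 0 < delta, all (fun b => 0 < b.1) bs &
    periodic_off P x delta bs].
Proof.
elim=> [f hf|m f hm hf|Q _ [d [bs [d0 pos per]]]
       |Q R _ [d1 [bs1 [d10 pos1 per1]]] _ [d2 [bs2 [d20 pos2 per2]]]
       |Q R QR _ [d [bs [d0 pos per]]]].
- have [a [g [hg fE]]] := affine_update x hf.
  have [c0|c0|c0] := ltrgt0P a.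
  + have [l gE] := affine_opp hg.
    exists 1, [:: (a, l)]; split=> //=; first by rewrite c0.
    move=> e v /=; rewrite orbF /crosses !fE /= -gE; lia.
  (* With a negative slope the inequality becomes false exactly when [- a * v] reaches [g e + 1],
     hence the shift by 1. *)
  + have [l gE] := affine_add hg (affine_const _ 1).
    exists 1, [:: (- a, l)]; split=> //=; first by rewrite oppr_gt0 c0.
    move=> e v /=; rewrite orbF /crosses !fE /= -gE; lia.
  + by exists 1, [::]; split=> // e v _; rewrite !fE c0 !mul0r.
- have [a [g [hg fE]]] := affine_update x hf.
  exists m, [::]; split=> // e v _; rewrite !fE.
  have -> : a * (v - m) + g e = a * v + g e + (- a) * m by lia.
  have h : (- a) * m \in dvdz m by apply: dvdz_mull.
  by rewrite (rpredDr _ h).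
- exists d, bs; split=> // e v /per[h1 h2].
  by split=> h; [move/h2 | move/h1].
- exists (d1 * d2), (bs1 ++ bs2); split.
  + exact: mulr_gt0.
  + by rewrite all_cat pos1.
  have e1 : d1 * d2 = d1 * `|d2|%N%:Z by lia.
  have e2 : d1 * d2 = d2 * `|d1|%N%:Z by lia.
  move=> e v; rewrite has_cat negb_or => /andP[h1 h2].
  move: (h1) (h2); rewrite {1}e1 {1}e2 => h1' h2'.
  have := periodic_offM d10 pos1 per1 h1'; rewrite -e1.
  have := periodic_offM d20 pos2 per2 h2'; rewrite -e2.
  tauto.
- by exists d, bs; split=> // e v /per h; rewrite -!QR.
Qed.

(* Cooper's argument: a witness can be moved by multiples of the period until a
   boundary lies within one period of it; the extra boundary v = 0 makes sure
   that there is one. *)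
Lemma witness_near_boundary P x (delta : int) (bs : seq (int * affine_form X))
    e v :
  0 < delta -> all (fun b => 0 < b.1) bs -> (1, ([ffun=> 0], 0)) \in bs ->
  periodic_off P x delta bs -> P (update e x v) ->
  exists2 b, b \in bs & exists2 w,
    - (b.1 * delta) <= b.1 * w - aff_eval b.2 e < b.1 * delta &
    P (update e x w).
Proof.
move=> d0 pos b0 per Pv.
have near w : P (update e x w) -> has (crosses e w delta) bs ->
    exists2 b, b \in bs & exists2 w,
    - (b.1 * delta) <= b.1 * w - aff_eval b.2 e < b.1 * delta &
    P (update e x w).
  move=> Pw /hasP[b bb /andP[h1 h2]]; exists b => //; exists w => //.
  have := mulr_gt0 (allP pos _ bb) d0.
  move: h1 h2; rewrite mulrBr.
  by move: (b.1 * w) (b.1 * delta) (aff_eval _ _) => p q r; lia.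
have near' w : P (update e x w) -> has (crosses e (w + delta) delta) bs ->
    exists2 b, b \in bs & exists2 w,
    - (b.1 * delta) <= b.1 * w - aff_eval b.2 e < b.1 * delta &
    P (update e x w).
  move=> Pw /hasP[b bb /andP[h1 h2]]; exists b => //; exists w => //.
  have := mulr_gt0 (allP pos _ bb) d0.
  move: h1 h2; rewrite addrK mulrDr.
  by move: (b.1 * w) (b.1 * delta) (aff_eval _ _) => p q r; lia.
have ev0 : aff_eval ([ffun=> 0], 0) e = 0.
  by rewrite /aff_eval big1 //= => y _; rewrite ffunE mul0r.
(* Induction on [|v|]: as long as no boundary is crossed, [v] moves by [delta] towards 0, and within
   distance [delta] of 0 the extra boundary serves. *)
elim: {v}_.+1 {-2}v (ltnSn `|v|) Pv => // n IH v vn Pv.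
have [v0|v0] := leP 0 v.
  have [/near|/per] := boolP (has (crosses e v delta) bs); first exact.
  move=> h; have [h'|h'] := ltP v delta.
    exists (1, ([ffun=> 0], 0)) => //=; exists v => //; rewrite ev0; lia.
  apply: (IH (v - delta)); first by lia.
  exact/h.
have [/near'|/per] := boolP (has (crosses e (v + delta) delta) bs); first exact.
move=> h; have [h'|h'] := leP (- delta) v.
  exists (1, ([ffun=> 0], 0)) => //=; exists v => //; rewrite ev0; lia.
apply: (IH (v + delta)); first by lia.
by apply/h; rewrite addrK.
Qed.

Lemma qf_ex1 P x : qf P -> qf (fun e => exists v, P (update e x v)).
Proof.
move=> hP; have [delta [bs [d0 pos per]]] := qf_periodic x hP.
pose bs' := (1, ([ffun=> 0], 0)) :: bs.
have pos' : all (fun b : int * affine_form X => 0 < b.1) bs' by [].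
have per' : periodic_off P x delta bs'.
  by move=> e v /=; rewrite negb_or => /andP[_ /per].
(* The witnesses near a boundary [b] satisfy [b.1 * v = aff_eval b.2 e + i - b.1 * delta] with
   [0 <= i < 2 * b.1 * delta], which leaves a finite disjunction of instances of [qf_solve]. *)
pose Q (b : int * affine_form X) e := exists2 i : nat,
  i \in iota 0 (absz (b.1 * delta + b.1 * delta)) &
  exists2 v, b.1 * v = aff_eval b.2 e + (i%:Z - b.1 * delta) &
             P (update e x v).
have hQ : forall b, b \in bs' -> qf (Q b).
  move=> b bb; apply: qf_ex_seq => i _; apply: qf_solve => //.
    exact: (allP pos').
  exact: affine_add (affine_aff_eval _) (affine_const _ _).
apply: qf_ext (qf_ex_seq hQ) => e; split.
  by case=> b _ [i _ [v _ Pv]]; exists v.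
case=> v /(witness_near_boundary d0 pos' (mem_head _ _) per')[b bb [w hw Pw]].
exists b => //; have /= b0 := allP pos' _ bb.
exists (absz (b.1 * w - aff_eval b.2 e + b.1 * delta)).
  rewrite mem_iota; move: hw.
  by move: (b.1 * w) (b.1 * delta) (aff_eval _ _) => p q r; lia.
exists w => //; move: hw.
by move: (b.1 * w) (b.1 * delta) (aff_eval _ _) => p q r; lia.
Qed.

Lemma qf_ex_mem P (s : seq X) : qf P ->
  qf (fun e => exists2 e' : {ffun X -> int}, (forall y, y \notin s -> e' y = e y) & P e').
Proof.
move=> hP; elim: s => [|x s IH].
  apply: qf_ext hP => e; split=> [Pe|[e' he Pe]]; first by exists e.
  by have <- : e' = e by apply/ffunP => y; apply: he.
apply: qf_ext (qf_ex1 x IH) => e; split.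
  case=> v [e' he Pe]; exists e' => // y; rewrite inE negb_or => /andP[yx ys].
  by rewrite he // ffunE (negPf yx).
case=> e' he Pe; exists (e' x), e' => // y ys; rewrite ffunE.
by have [->//|yx] := eqVneq y x; apply: he; rewrite inE negb_or yx.
Qed.

End Qf.

(** Eliminates a whole block of integer variables, indexed by a type of its own. This is the form
    needed for a quantifier over a lattice vector. *)
Lemma qf_ex_block (X I Y : finType) (P : {ffun Y -> int} -> Prop)
    (h : {ffun X -> int} -> {ffun I -> int} -> {ffun Y -> int}) :
  (forall y, affine (fun e : {ffun X + I -> int} =>
     h [ffun x => e (inl x)] [ffun i => e (inr i)] y)) ->
  qf P -> qf (fun e => exists w, P (h e w)).
Proof.
move=> hh /(qf_comp hh) hP.
have hE := qf_ex_mem [seq inr i | i <- enum I] hP.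
(* The default 0 on the block is arbitrary, since all these coordinates are then chosen anew. *)
pose m (e : {ffun X -> int}) : {ffun X + I -> int} :=
  [ffun u => if u is inl x then e x else 0].
have hm u : affine (fun e => m e u).
  case: u => [x|i].
    by apply: affine_ext (affine_var x) => e; rewrite ffunE.
  by apply: affine_ext (affine_const _ 0) => e; rewrite ffunE.
apply: qf_ext (qf_comp hm hE) => e; split.
  case=> e' he Pe; exists [ffun i => e' (inr i)].
  suff <- : [ffun x => e' (inl x)] = e by [].
  apply/ffunP => x; rewrite ffunE he ?ffunE //.
  by apply/mapP => -[].
case=> w Pw; exists [ffun u => match u with inl x => e x | inr i => w i end].
  case=> [x|i]; first by rewrite !ffunE.
  by rewrite mem_map ?mem_enum //; apply: inr_inj.
set e1 := [ffun x => _]; set w1 := [ffun i => _ (inr i)].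
have -> : e1 = e by apply/ffunP => x; rewrite !ffunE.
by have -> : w1 = w by apply/ffunP => x; rewrite !ffunE.
Qed.

(** * Dickson's lemma and decomposition into linear sets *)

(** Induction on the measures. Let [s0] dominate from below for the remaining ones, and let [b]
    bound [mu] on [s0]. If [b <= mu x], then [s0] serves [x]; otherwise [x] lies in one of the
    slices [mu = m] with [m < b], each of which has its own finite list. *)
Lemma dickson (T : eqType) (mus : seq (T -> nat)) (P : T -> Prop) :
  exists2 s : seq T, (forall y, y \in s -> P y) &
    forall x, P x -> exists2 y, y \in s & all (fun mu => mu y <= mu x)%N mus.
Proof.
elim: mus P => [|mu mus IH] P.
  have [[x Px]|nP] := pselect (exists x, P x).
    exists [:: x] => [y|y _]; first by rewrite inE => /eqP->.
    by exists x; rewrite ?mem_head.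
  by exists [::] => // x Px; case: nP; exists x.
have [s0 s0P dom0] := IH P.
have /choice[f fP] m : exists s : seq T,
    (forall y, y \in s -> P y /\ mu y = m) /\
    (forall x, P x /\ mu x = m ->
       exists2 y, y \in s & all (fun nu => nu y <= nu x)%N mus).
  have [s sP dom] := IH (fun x => P x /\ mu x = m).
  by exists s; split=> // y /sP.
pose b := (\max_(y <- s0) mu y)%N.
exists (s0 ++ flatten [seq f m | m <- iota 0 b]).
  move=> y; rewrite mem_cat => /orP[/s0P//|/flatten_mapP[m _ ym]].
  by have [/(_ _ ym)[]] := fP m.
move=> x Px; have [xb|xb] := ltnP (mu x) b.
  have [h1 h2] := fP (mu x); have [y ys dom] := h2 x (conj Px erefl).
  exists y => /=; last by have [_ ->] := h1 _ ys; rewrite leqnn.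
  rewrite mem_cat; apply/orP; right; apply/flatten_mapP.
  by exists (mu x); rewrite ?mem_iota.
have [y ys dom] := dom0 x Px; exists y; rewrite ?mem_cat ?ys //= dom andbT.
by apply: leq_trans xb; rewrite /b (big_rem y) //= leq_maxl.
Qed.

(** The additive submonoid generated by [A]. *)
Inductive star (V : zmodType) (A : V -> Prop) : V -> Prop :=
| star0 : star A 0
| starS x z : A x -> star A z -> star A (x + z).

Section Star.
Variable V : zmodType.
Implicit Types A B K : V -> Prop.

Lemma star_sub A K : K 0 -> (forall x y, A x -> K y -> K (x + y)) ->
  forall z, star A z -> K z.
Proof. by move=> K0 KD z; elim=> // x w Ax _ /(KD _ _ Ax). Qed.

Lemma star_mono A B : (forall x, A x -> B x) -> forall z, star A z -> star B z.
Proof.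
move=> AB; apply: star_sub => [|x y /AB]; [exact: star0 | exact: starS].
Qed.

Lemma starD A x y : star A x -> star A y -> star A (x + y).
Proof.
move=> hx hy; elim: hx => [|u w Au _ IH]; first by rewrite add0r.
by rewrite -addrA; apply: starS.
Qed.

Lemma star1 A x : A x -> star A x.
Proof. by move=> Ax; rewrite -[x]addr0; apply: starS => //; apply: star0. Qed.

Lemma star_muln A x n : A x -> star A (x *+ n).
Proof.
move=> Ax; elim: n => [|n IH]; first by rewrite mulr0n; apply: star0.
by rewrite mulrS; apply: starS.
Qed.

Lemma star_cons (p : V) (s : seq V) z :
  star (fun x => x \in p :: s) z <->
  exists n : nat, star (fun x => x \in s) (z - p *+ n).
Proof.
split.
  elim=> [|x w xs _ [n IH]].
    by exists 0%N; rewrite mulr0n subr0; apply: star0.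
  move: xs; rewrite inE => /orP[/eqP->|xs].
    by exists n.+1; rewrite mulrS opprD addrACA subrr add0r.
  by exists n; rewrite -addrA; apply: starS.
case=> n h; rewrite -(subrK (p *+ n) z); apply: starD.
  by apply: star_mono h => x xs; rewrite inE xs orbT.
by apply: star_muln; rewrite mem_head.
Qed.

End Star.

Lemma ffun_mulrnE (X : finType) (p : {ffun X -> int}) n x :
  (p *+ n) x = p x * n%:Z.
Proof.
elim: n => [|n IH]; first by rewrite mulr0n ffunE mulr0.
by rewrite mulrS ffunE IH -[n.+1]add1n PoszD mulrDr mulr1.
Qed.

Definition join_var (X : finType) (e : {ffun X -> int}) (w : {ffun unit -> int}) :
    {ffun X + unit -> int} :=
  [ffun u => match u with inl x => e x | inr i => w i end].

(** Periods are peeled off one by one: the multiplicity of the first one is an existentially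
    quantified natural number, which quantifier elimination removes. *)
Lemma qf_star (X : finType) (s : seq {ffun X -> int}) :
  qf (star (fun x => x \in s)).
Proof.
elim: s => [|p s IH].
  apply: (@qf_ext _ (fun z => forall x, z x = 0)); last first.
    by apply: qf_all_fin => x; apply: qf_eq (affine_var x) (affine_const _ 0).
  move=> z; split=> [z0|].
    have -> : z = 0 by apply/ffunP => x; rewrite z0 ffunE.
    exact: star0.
  by case=> [x|//]; rewrite ffunE.
(* The variable [inr tt] is the multiplicity of [p]. *)
pose P (u : {ffun X + unit -> int}) := 0 <= u (inr tt) /\
  star (fun x => x \in s) [ffun x => u (inl x) - p x * u (inr tt)].
have hP : qf P.
  apply: qf_and; first exact/qf_ge/affine_var.
  apply: qf_comp IH => x.
  apply: (@affine_ext _ (fun u => u (inl x) - p x * u (inr tt))) => [u|].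
    by rewrite ffunE.
  apply: affine_sub (affine_var _) _; apply: affine_scale; exact: affine_var.
have hj y : affine (fun e : {ffun X + unit -> int} =>
    join_var [ffun x => e (inl x)] [ffun i => e (inr i)] y).
  apply: affine_ext (affine_var y) => e; rewrite ffunE.
  by case: y => i; rewrite ffunE.
apply: qf_ext (qf_ex_block hj hP) => z; rewrite star_cons; split.
  case=> w []; rewrite ffunE; case wn: (w tt) => [n|//] _ h.
  exists n; congr (star _ _): h; apply/ffunP => x.
  by rewrite !ffunE ?wn ffun_mulrnE.
case=> n h; exists [ffun=> n%:Z]; split; first by rewrite !ffunE.
congr (star _ _): h; apply/ffunP => x.
by rewrite !ffunE ffun_mulrnE.
Qed.

Section Orthants.
Variable X : finType.
Implicit Types (x y z : {ffun X -> int}) (K : {ffun X -> int} -> Prop).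

(* The measures of [f] are dominated exactly when [f] keeps its sign and does
   not decrease in absolute value. *)
Definition signed_measures (T : Type) (f : T -> int) : seq (T -> nat) :=
  [:: fun e => absz (f e); fun e => nat_of_bool (0 <= f e);
      fun e => nat_of_bool (f e < 0)].

Lemma signed_measuresP (T : Type) (f : T -> int) a b :
  all (fun mu => mu a <= mu b)%N (signed_measures f) ->
  if 0 <= f a then 0 <= f a <= f b else f b <= f a < 0.
Proof. rewrite /=; case: ifP; lia. Qed.

Definition coord_measures : seq ({ffun X -> int} -> nat) :=
  flatten [seq signed_measures (fun z : {ffun X -> int} => z i) | i <- enum X].

Lemma coord_measuresP x y i :
  all (fun mu => mu y <= mu x)%N coord_measures ->
  if 0 <= y i then 0 <= y i <= x i else x i <= y i < 0.
Proof.
move=> h; apply: (signed_measuresP (f := fun z : {ffun X -> int} => z i)).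
apply/allP => mu hmu; apply: (allP h); apply/flatten_mapP.
by exists i; rewrite ?mem_enum.
Qed.

Definition weight z : nat := (\sum_i absz (z i))%N.

Lemma weight_subr x y :
  all (fun mu => mu y <= mu x)%N coord_measures -> y != 0 ->
  (weight (x - y)%R < weight x)%N.
Proof.
move=> h y0.
have [i yi] : exists i, y i != 0.
  apply: contrapT => /forallNP h0; case/eqP: y0; apply/ffunP => i.
  by rewrite ffunE; have /negP := h0 i; rewrite negbK => /eqP.
rewrite /weight (bigD1 i) //= [in X in (_ < X)%N](bigD1 i) //= -addSn.
apply: leq_add.
  have := coord_measuresP i h; rewrite !ffunE; move: (x i) (y i) yi => p q.
  by case: ifP; lia.
apply: leq_sum => j _.
have := coord_measuresP j h; rewrite !ffunE; move: (x j) (y j) => p q.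
by case: ifP; lia.
Qed.

(** By Dickson's lemma, finitely many non-zero elements of [K] are such that each non-zero element
    dominates one of them. Subtracting it stays in [K] and lowers [weight], so descent ends at 0.
    The measures [mus] restrict the differences for which closure has to be checked. *)
Lemma star_generated K (mus : seq ({ffun X -> int} -> nat)) :
  (forall x y, K x -> K y ->
     all (fun mu => mu y <= mu x)%N (coord_measures ++ mus) -> K (x - y)) ->
  exists2 s : seq {ffun X -> int}, (forall y, y \in s -> K y) &
    forall x, K x -> star (fun y => y \in s) x.
Proof.
move=> KB.
have [s sK dom] := dickson (coord_measures ++ mus) (fun x => K x /\ x <> 0).
exists s => [y /sK[]//|x Kx].
elim: {x}_.+1 {-2}x (ltnSn (weight x)) Kx => // n IH x xn Kx.
have [->|/eqP x0] := eqVneq x 0; first exact: star0.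
have [y ys yx] := dom x (conj Kx x0).
have [Ky /eqP y0] := sK y ys.
rewrite -(subrK y x) addrC; apply: starS => //; apply: IH; last exact: KB.
rewrite ltnS in xn; apply: leq_trans xn; apply: weight_subr => //.
by move: yx; rewrite all_cat => /andP[].
Qed.

(** Such a set is empty or a translate of a subgroup of Z^X, which is finitely generated even as a
    monoid by [star_generated]; so it is a translate of a [star]. *)
Lemma qf_affine_closed (D : {ffun X -> int} -> Prop) :
  (forall x y z, D x -> D y -> D z -> D (x - y + z)) -> qf D.
Proof.
move=> DB.
have [[z0 D0]|nD] := pselect (exists z, D z); last first.
  apply: qf_ext (qf_const _ False) => e; split=> // De.
  by case: nD; exists e.
have [x y Kx Ky _|s sK gen] := @star_generated (fun z => D (z + z0)) [::].
  have := DB _ _ _ Kx Ky D0; congr D.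
  by rewrite opprD addrACA subrr addr0.
have h : qf (fun z => star (fun y => y \in s) (z - z0)).
  apply: qf_comp (qf_star s) => x.
  apply: affine_ext (affine_add (affine_var x) (affine_const _ (- z0 x))) => e.
  by rewrite !ffunE.
apply: qf_ext h => z; split.
  move=> hz; rewrite -(subrK z0 z).
  apply: (star_sub (K := fun w => D (w + z0))) hz; first by rewrite add0r.
  move=> x y /sK Dx Dy; have := DB _ _ _ Dx D0 Dy.
  by rewrite addrK addrA.
by move=> Dz; apply: gen; rewrite subrK.
Qed.

Definition linear_part (l : affine_form X) z : int := \sum_x l.1 x * z x.

Lemma aff_evalD l x y : aff_eval l (x + y) = aff_eval l x + linear_part l y.
Proof.
rewrite /aff_eval /linear_part addrAC -big_split; congr (_ + _).
by apply: eq_bigr => i _; rewrite ffunE mulrDr.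
Qed.

Lemma linear_partD l x y :
  linear_part l (x + y) = linear_part l x + linear_part l y.
Proof.
by rewrite -big_split; apply: eq_bigr => i _; rewrite ffunE mulrDr.
Qed.

Lemma linear_partN l x : linear_part l (- x) = - linear_part l x.
Proof. by rewrite -sumrN; apply: eq_bigr => i _; rewrite ffunE mulrN. Qed.

(** Atoms see only the sign of a form or the residue of a form modulo some [m]. With [M] the product
    of the moduli, [P] is constant on the cells cut out by the signs and the residues modulo [M]. *)
Lemma qf_cells (P : {ffun X -> int} -> Prop) : qf P ->
  exists (ls : seq (affine_form X)) (M : int), 0 < M /\ forall x y,
    (forall l, l \in ls -> (0 <= aff_eval l x) = (0 <= aff_eval l y)) ->
    (forall i, (M %| x i - y i)%Z) -> P x <-> P y.
Proof.
elim=> [f [l fE]|m f m0 [l fE]|Q _ [ls [M [M0 h]]]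
       |Q R _ [ls1 [M1 [M10 h1]]] _ [ls2 [M2 [M20 h2]]]
       |Q R QR _ [ls [M [M0 h]]]].
- exists [:: l], 1; split=> // x y h _.
  by rewrite !fE (h l) // mem_head.
- exists [::], m; split=> // x y _ h.
  have hm : linear_part l (x - y) \in dvdz m.
    apply: rpred_sum => i _; apply: dvdz_mull; rewrite !ffunE; exact: h.
  by rewrite !fE -{1}(subrK y x) addrC aff_evalD (rpredDr _ hm).
- by exists ls, M; split=> // x y h1 h2; have := h x y h1 h2; tauto.
- exists (ls1 ++ ls2), (M1 * M2); split=> [|x y hl hM]; first exact: mulr_gt0.
  have := h1 x y; have := h2 x y.
  have d1 i : (M1 %| x i - y i)%Z.
    by apply: dvdz_trans (hM i); apply: dvdz_mulr.
  have d2 i : (M2 %| x i - y i)%Z.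
    by apply: dvdz_trans (hM i); apply: dvdz_mull.
  move=> /(_ _ d2) h2' /(_ _ d1) h1'.
  rewrite h1' => [|l ll]; last by apply: hl; rewrite mem_cat ll.
  by rewrite h2' => // l ll; apply: hl; rewrite mem_cat ll orbT.
- by exists ls, M; split=> // x y h1 h2; rewrite -!QR; apply: h.
Qed.

Definition in_orthant (sigma : {ffun X -> bool}) z : Prop :=
  forall i, if sigma i then z i <= 0 else 0 <= z i.

(* The recession cone of the cell of [y] cut out by the forms [ls], the
   coordinate hyperplanes and the residues modulo [M]. *)
Definition cell_cone (ls : seq (affine_form X)) (M : int)
    (y k : {ffun X -> int}) : Prop :=
  [/\ forall i, (M %| k i)%Z,
      forall i, if 0 <= y i then 0 <= k i else k i <= 0 &
      forall l, l \in ls -> if 0 <= aff_eval l y then 0 <= linear_part l k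
                            else linear_part l k <= 0].

Lemma cell_coneD ls M y k k' :
  cell_cone ls M y k -> cell_cone ls M y k' -> cell_cone ls M y (k + k').
Proof.
move=> [h1 h2 h3] [h1' h2' h3']; split=> [i|i|l ll].
- rewrite ffunE; apply: rpredD; [exact: h1 | exact: h1'].
- move: (h2 i) (h2' i); rewrite ffunE; move: (k i) (k' i) => p q.
  by case: ifP; lia.
- by move: (h3 l ll) (h3' l ll); rewrite linear_partD; case: ifP; lia.
Qed.

(** Adding the measures of the linear parts keeps the sign conditions when a dominated element is
    subtracted, as [star_generated] requires. *)
Lemma cell_cone_generated ls M y :
  exists2 s : seq {ffun X -> int}, (forall k, k \in s -> cell_cone ls M y k) &
    forall k, cell_cone ls M y k -> star (fun p => p \in s) k.
Proof.
apply: (@star_generated _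
  (flatten [seq signed_measures (linear_part l) | l <- ls])).
move=> k k' [h1 h2 h3] [h1' h2' h3']; rewrite all_cat => /andP[hc hl].
split=> [i|i|l ll].
- rewrite !ffunE; apply: rpredB; [exact: h1 | exact: h1'].
- move: (h2 i) (h2' i) (coord_measuresP i hc); rewrite !ffunE.
  move: (k i) (k' i) => p q; by case: ifP => _; case: ifP => _; lia.
- have hs :
      all (fun mu => mu k' <= mu k)%N (signed_measures (linear_part l)).
    apply/allP => mu hmu; apply: (allP hl); apply/flatten_mapP.
    by exists l.
  move: (h3 l ll) (h3' l ll) (signed_measuresP hs); rewrite linear_partD linear_partN.
  by case: ifP => _; case: ifP => _; lia.
Qed.

(** Dickson's lemma, applied to coordinates, forms and residues, gives finitely many [y] in [P] such
    that each [z] in [P] lies in [y] plus the cone of the cell of [y]. Moving along this cone does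
    not leave the cell, so it stays in [P]; both [y] and the cone lie in one orthant. *)
Lemma qf_linear_sets (P : {ffun X -> int} -> Prop) : qf P ->
  exists L : seq ({ffun X -> bool} * {ffun X -> int} * seq {ffun X -> int}),
  (forall l, l \in L -> in_orthant l.1.1 l.1.2 /\
     forall p, p \in l.2 -> in_orthant l.1.1 p) /\
  forall z, P z <->
    exists2 l, l \in L & star (fun p => p \in l.2) (z - l.1.2).
Proof.
move=> /qf_cells[ls [M [M0 cell]]].
have /choice[ps psP] y : exists s : seq {ffun X -> int},
    (forall k, k \in s -> cell_cone ls M y k) /\
    (forall k, cell_cone ls M y k -> star (fun p => p \in s) k).
  by have [s h1 h2] := cell_cone_generated ls M y; exists s.
pose res (z : {ffun X -> int}) i := absz (z i %% M)%Z.
(* Having both the residue and its complement to [M] as measures turns domination into equality of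
   residues. *)
pose mus : seq ({ffun X -> int} -> nat) :=
  flatten [seq signed_measures (aff_eval l) | l <- ls] ++
  flatten [seq [:: fun z => res z i; fun z => absz M - res z i]%N | i <- enum X].
have [s sP dom] := dickson (coord_measures ++ mus) P.
pose lin y := ([ffun i => y i < 0], y, ps y).
exists (map lin s); split.
  move=> _ /mapP[y ys ->] /=; split=> [i|p /(proj1 (psP y))[_ h _] i].
    by rewrite ffunE; move: (y i) => q; case: ifP; lia.
  have := h i; rewrite ffunE; move: (y i) (p i) => q r.
  by case: ifP; case: ifP; lia.
move=> z; split.
  move=> /dom[y ys]; rewrite !all_cat => /and3P[hc hl hr].
  exists (lin y); first exact: map_f.
  apply: (proj2 (psP y)); split=> [i|i|l ll].
  - have hi : all (fun mu : {ffun X -> int} -> nat => mu y <= mu z)%N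
        [:: fun z => res z i; fun z => absz M - res z i]%N.
      apply/allP => mu hmu; apply: (allP hr); apply/flatten_mapP.
      by exists i; rewrite ?mem_enum.
    rewrite !ffunE -eqz_mod_dvd; move: hi; rewrite /= /res andbT.
    have := modz_ge0 (z i) (lt0r_neq0 M0); have := ltz_pmod (z i) M0.
    have := modz_ge0 (y i) (lt0r_neq0 M0); have := ltz_pmod (y i) M0.
    by move: (y i %% M)%Z (z i %% M)%Z => p q; lia.
  - have := coord_measuresP i hc; rewrite !ffunE; move: (y i) (z i) => p q.
    by case: ifP; lia.
  - have hs :
        all (fun mu => mu y <= mu z)%N (signed_measures (aff_eval l)).
      apply/allP => mu hmu; apply: (allP hl); apply/flatten_mapP.
      by exists l.
    move: (signed_measuresP hs); rewrite -{1 2}(subrK y z) [z - y + y]addrC aff_evalD /=.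
    move: (aff_eval l y) (linear_part l _) => p q.
    by case: ifP; lia.
case=> _ /mapP[y ys ->] /= hz.
have [h1 h2 h3] : cell_cone ls M y (z - y).
  elim: hz => [|p w pp _]; last by apply: cell_coneD; apply: (proj1 (psP y)).
  split=> [i|i|l ll].
  - by rewrite ffunE dvdz0.
  - by rewrite ffunE; case: ifP.
  - rewrite /linear_part big1 => [|i _]; last by rewrite ffunE mulr0.
    by case: ifP.
apply: (proj2 (cell z y _ _)) (sP y ys) => [l ll|i].
  rewrite -{1}(subrK y z) addrC aff_evalD.
  have := h3 l ll; move: (aff_eval l y) (linear_part l _) => p q.
  by case: ifP; lia.
by have := h1 i; rewrite !ffunE.
Qed.

End Orthants.

(** * Semilinear sets and sums along paths *)

Section Semilinear.
Variable V : zmodType.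
Implicit Types (A B : V -> Prop) (l : V * seq V) (L : seq (V * seq V)).

Definition linear_set l z : Prop := star (fun p => p \in l.2) (z - l.1).

Definition semilinear_set A : Prop :=
  exists L, forall z, A z <-> exists2 l, l \in L & linear_set l z.

Lemma semilinear_ext A B : (forall z, A z <-> B z) -> semilinear_set A ->
  semilinear_set B.
Proof. by move=> AB [L h]; exists L => z; rewrite -AB. Qed.

Lemma star_nil z : star (fun x : V => x \in [::]) z <-> z = 0.
Proof. by split=> [[]//|->]; apply: star0. Qed.

Lemma semilinear0 : semilinear_set (fun=> False).
Proof. by exists [::] => z; split=> // -[]. Qed.

Lemma semilinear1 v : semilinear_set (fun z => z = v).
Proof.
exists [:: (v, [::])] => z; split=> [->|[l]].
  by exists (v, [::]); rewrite ?mem_head // /linear_set subrr; apply: star0.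
rewrite inE => /eqP-> /star_nil /eqP; rewrite subr_eq0.
by move/eqP.
Qed.

Lemma semilinearU A B : semilinear_set A -> semilinear_set B ->
  semilinear_set (fun z => A z \/ B z).
Proof.
move=> [L hL] [M hM]; exists (L ++ M) => z; rewrite hL hM; split.
  by case=> -[l lL lz]; exists l; rewrite // mem_cat lL ?orbT.
by case=> l; rewrite mem_cat => /orP[] lL lz; [left | right]; exists l.
Qed.

Lemma semilinear_ex_fin (I : finType) (A : I -> V -> Prop) :
  (forall i, semilinear_set (A i)) -> semilinear_set (fun z => exists i, A i z).
Proof.
move=> hA; suff h (s : seq I) : semilinear_set (fun z => exists2 i : I, i \in s & A i z).
  apply: semilinear_ext (h (enum I)) => z.
  by split=> -[i]; [exists i | exists i; rewrite ?mem_enum].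
elim: s => [|i s IH].
  by apply: semilinear_ext semilinear0 => z; split=> // -[].
apply: semilinear_ext (semilinearU (hA i) IH) => z; split.
  by case=> [h|[j js h]]; [exists i | exists j] => //; rewrite inE ?eqxx ?js ?orbT.
by case=> j; rewrite inE => /orP[/eqP->|js] h; [left | right; exists j].
Qed.

Lemma starU A B z :
  star (fun x => A x \/ B x) z <-> exists x, star A x /\ star B (z - x).
Proof.
split.
  elim=> [|x w xAB _ [u [hu hw]]].
    by exists 0; rewrite subr0; split; apply: star0.
  case: xAB => hx.
    by exists (x + u); rewrite opprD addrACA subrr add0r; split=> //; apply: starS.
  by exists u; rewrite -addrA; split=> //; apply: starS.
case=> x [hA hB]; rewrite -(subrK x z) addrC; apply: starD.
  by apply: star_mono hA => y; left.
by apply: star_mono hB => y; right.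
Qed.

(** The sum of two linear sets has the sum of the bases as its base and all the periods of both. *)
Lemma semilinearD A B : semilinear_set A -> semilinear_set B ->
  semilinear_set (fun z => exists x, A x /\ B (z - x)).
Proof.
move=> [L hL] [M hM].
exists [seq (l.1 + m.1, l.2 ++ m.2) | l <- L, m <- M] => z.
have swap (u v w y : V) : u - w - y = u - (v + y) - (w - v).
  by rewrite opprD opprB !addrA [RHS](ACl (1*5*3*(2*4)))/= addNr addr0.
have catE l m y : star (fun x => x \in l.2 ++ m.2) y <->
    exists x, star (fun p => p \in l.2) x /\ star (fun p => p \in m.2) (y - x).
  rewrite -starU; split; apply: star_mono => x; rewrite mem_cat.
    by case/orP; [left | right].
  by case=> ->; rewrite ?orbT.
split.
  case=> x [/hL[l lL lx] /hM[m mM mx]].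
  exists (l.1 + m.1, l.2 ++ m.2); first by apply/allpairsP; exists (l, m).
  rewrite /linear_set catE; exists (x - l.1); split=> //.
  by move: mx; congr star; rewrite /= -swap.
case=> _ /allpairsP[[l m] /= [lL mM ->]]; rewrite /linear_set catE => -[x [hl hm]].
exists (x + l.1); split; first by apply/hL; exists l; rewrite // /linear_set addrK.
apply/hM; exists m => //; move: hm; congr star => /=.
by rewrite !opprD !addrA [LHS](ACl (1*4*2*3)).
Qed.

(** A non-empty sum of elements of the linear set uses its base at least once; further copies of the
    base act as a period. *)
Lemma star_linear_set l z :
  star (linear_set l) z <-> z = 0 \/ linear_set (l.1, l.1 :: l.2) z.
Proof.
split.
  elim=> [|x w lx _ IH]; [by left | right; rewrite /linear_set /=].
  have lx' : star (fun p => p \in l.1 :: l.2) (x - l.1).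
    by apply: star_mono lx => p pl; rewrite inE pl orbT.
  case: IH => [->|lw]; first by rewrite addr0.
  rewrite addrAC; apply: starD => //; rewrite -(subrK l.1 w) addrC.
  by apply: starS => //; rewrite mem_head.
case=> [->|/star_cons[n hn]]; first exact: star0.
have -> : z = l.1 *+ n + (z - l.1 *+ n) by rewrite addrC subrK.
have l1 : linear_set l l.1 by rewrite /linear_set subrr; apply: star0.
apply: starD; first exact: star_muln.
by apply: star1; move: hn; congr star; rewrite addrAC.
Qed.

(** By commutativity the star of a union is the sum of the stars ([starU]), so one linear set is
    split off at a time. *)
Lemma semilinear_star A : semilinear_set A -> semilinear_set (star A).
Proof.
case=> L; elim: L A => [|l L IH] A hA.
  apply: semilinear_ext (semilinear1 0) => z; split=> [->|]; first exact: star0.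
  by apply: (star_sub (K := fun y => y = 0)) => // x y /hA[].
pose B z := exists2 m, m \in L & linear_set m z.
have hl : semilinear_set (star (linear_set l)).
  apply: (@semilinear_ext (fun z => z = 0 \/ linear_set (l.1, l.1 :: l.2) z)).
    by move=> z; rewrite star_linear_set.
  apply: semilinearU (semilinear1 0) _.
  exists [:: (l.1, l.1 :: l.2)] => z; split=> [h|[m]].
    by exists (l.1, l.1 :: l.2); rewrite ?mem_head.
  by rewrite inE => /eqP->.
have hB : semilinear_set (star B) by apply: IH.
apply: semilinear_ext (semilinearD hl hB) => z; rewrite -starU.
split; apply: star_mono => x; rewrite hA.
  by case=> [h|[m mL h]]; [exists l | exists m]; rewrite // inE ?eqxx ?mL ?orbT.
by case=> m; rewrite inE => /orP[/eqP->|mL] h; [left | right; exists m].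
Qed.

Variables (Q : finType) (E : Q -> Q -> V -> Prop).

(** Paths have at least one edge, and only their intermediate vertices are confined to [S], as in
    Kleene's algorithm. *)
Inductive path_sum (S : seq Q) : Q -> Q -> V -> Prop :=
| path_edge p q z : E p q z -> path_sum S p q z
| path_step p r q y z : E p r y -> r \in S -> path_sum S r q z ->
    path_sum S p q (y + z).

Lemma path_sum_cat S p r q y z : path_sum S p r y -> r \in S ->
  path_sum S r q z -> path_sum S p q (y + z).
Proof.
elim=> [p' r' y' h|p' s r' x y' h sS _ IH] rS hz; first exact: path_step h rS hz.
by rewrite -addrA; apply: path_step h sS _; apply: IH.
Qed.

Lemma path_sum_mono S S' p q z : {subset S <= S'} ->
  path_sum S p q z -> path_sum S' p q z.
Proof.
move=> SS'; elim=> [p' q' y h|p' r q' x y h /SS' rS _ IH].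
  exact: path_edge.
exact: path_step h rS IH.
Qed.

(** Kleene's recursion: a path either avoids [s] in between or is cut at its visits to [s] into a
    first piece, a number of loops and a last piece. *)
Lemma path_sum_cons s S p q z :
  path_sum (s :: S) p q z <-> path_sum S p q z \/
    exists x, path_sum S p s x /\
      exists y, star (path_sum S s s) y /\ path_sum S s q (z - x - y).
Proof.
have sub : {subset S <= s :: S} by move=> r; rewrite inE orbC => ->.
split.
  elim=> [p' q' y h|p' r q' x y h]; first by left; apply: path_edge.
  rewrite inE => /orP[/eqP rs|rS] _ IH; last first.
    case: IH => [hy|[u [hu hrest]]].
      by left; apply: path_step h rS hy.
    right; exists (x + u); split; first exact: path_step h rS hu.
    by rewrite opprD addrACA subrr add0r.
  subst r; right; exists x; split; first exact: path_edge.
  rewrite [x + y]addrC addrK.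
  case: IH => [hy|[u [hu [v [hv hrest]]]]].
    by exists 0; rewrite subr0; split=> //; apply: star0.
  exists (u + v); rewrite opprD addrA; split=> //; exact: starS.
case=> [|[x [hx [y [hy hz]]]]]; first exact: path_sum_mono.
have -> : z = x + (y + (z - x - y)) by rewrite [y + _]addrC subrK addrC subrK.
apply: path_sum_cat (mem_head _ _) _; first exact: path_sum_mono hx.
elim: hy (z - x - y) hz => [|u v hu _ IH] w hw.
  by rewrite add0r; apply: path_sum_mono hw.
rewrite -addrA; apply: path_sum_cat (mem_head _ _) (IH _ hw).
exact: path_sum_mono hu.
Qed.

Lemma semilinear_path_sum S p q :
  (forall r s, semilinear_set (E r s)) -> semilinear_set (path_sum S p q).
Proof.
move=> hE; elim: S p q => [|s S IH] p q.
  apply: semilinear_ext (hE p q) => z; split; first exact: path_edge.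
  by case=> // p' r q' x y _; rewrite in_nil.
have h := semilinearD (semilinear_star (IH s s)) (IH s q).
apply: semilinear_ext (semilinearU (IH p q) (semilinearD (IH p s) h)) => z.
by rewrite path_sum_cons.
Qed.

End Semilinear.

Lemma semilinear_qf (X : finType) (P : {ffun X -> int} -> Prop) :
  semilinear_set P -> qf P.
Proof.
move=> [L hL].
have h l : l \in L -> qf (linear_set l).
  move=> _; apply: qf_comp (qf_star l.2) => x.
  apply: (@affine_ext _ (fun e => e x - l.1 x)) => [e|]; first by rewrite !ffunE.
  exact: affine_sub (affine_var x) (affine_const _ _).
by apply: qf_ext (qf_ex_seq h) => z; rewrite hL.
Qed.

(** * Asynchronous automata and EDT0L systems *)

Section AsyncToEDT0L.
Local Open Scope nat_scope.
Variables (n : nat) (A : finType) (M : async_automaton n.+1 A).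
Let V : finType := vertex M.
Let E : finType := async_edge n.+1 A V.
Let C : finType := (A + 'I_n.+1 * V)%type.

Fixpoint walk (v : V) (p : seq E) (v' : V) : bool :=
  if p is e :: p' then [&& e \in edges M, e.1.1 == v & walk e.2 p' v']
  else v == v'.

Lemma accepting_walk v p :
  accepting_path v p <-> exists2 v', v' \in accept M & walk v p v'.
Proof.
elim: p v => [|e p IH] v /=.
  by split=> [vM|[v' v'M /eqP->]//]; exists v.
split; first by case/and3P=> -> -> /IH.
by case=> v' v'M /and3P[-> -> h]; apply/IH; exists v'.
Qed.

Lemma walk_rcons v p e v' : walk v p e.1.1 -> e \in edges M -> e.2 = v' ->
  walk v (rcons p e) v'.
Proof.
move=> + eM <-; elim: p v => [|e' p IH] v /=; first by move/eqP->; rewrite eM !eqxx.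
by case/and3P=> -> -> /IH.
Qed.

Definition output (p : seq E) (i : 'I_n.+1) : seq A :=
  pmap (fun e : E => e.1.2 i) p.

(** An edge rewrites the nonterminals of all coordinates simultaneously, and [None] ends a run at an
    accept vertex. A letter that does not apply to the current vertex acts as the identity, so every
    control word is harmless and the control language may be full. *)
Definition rewrite_edge (b : option E) (c : C) : seq C :=
  match c, b with
  | inr (i, v), Some e =>
      if (e \in edges M) && (e.1.1 == v) then
        [seq inl x | x <- seq_of_opt (e.1.2 i)] ++ [:: inr (i, e.2)]
      else [:: c]
  | inr (i, v), None => if v \in accept M then [::] else [:: c]
  | inl _, _ => [:: c]
  end.

(* The sentential form in which coordinate [i] has emitted the word [u i] and
   ends in the nonterminal of the current vertex, if the run is not over. *)
Definition form (u : 'I_n.+1 -> seq A) (v : option V) : seq C :=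
  flatten [seq [seq inl x | x <- u i] ++
               (if v is Some v then [:: inr (i, v)] else [::])
          | i <- enum 'I_n.+1].

Lemma free_endo_form b u v : free_endo (rewrite_edge b) (form u v) =
  flatten [seq [seq inl x | x <- u i] ++
               (if v is Some v then rewrite_edge b (inr (i, v)) else [::])
          | i <- enum 'I_n.+1].
Proof.
rewrite /form; elim: (enum _) => //= i s <-.
rewrite /free_endo !map_cat !flatten_cat -map_comp.
congr ((_ ++ _) ++ _).
  by elim: (u i) => //= x w ->.
by case: v => //= v; rewrite cats0.
Qed.

Definition derive (r : seq (option E)) : seq C :=
  foldr (fun b => free_endo (rewrite_edge b)) (form (fun=> [::]) (Some (start M))) r.

(** The rightmost letter of a control word acts first, so the edges of the walk appear in reverse
    order. *)
Lemma derive_walk p v : walk (start M) p v ->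
  derive (rev (map Some p)) = form (output p) (Some v).
Proof.
elim/last_ind: p v => [|p e IH] v /=; first by move/eqP->.
rewrite map_rcons rev_rcons /= => h.
have [hp eM ev] : [/\ walk (start M) p e.1.1, e \in edges M & e.2 = v].
  move: h; elim: p (start M) {IH} => [|e' p IH] s /=.
    by case/and3P=> -> /eqP-> /eqP->; rewrite eqxx.
  by case/and3P=> -> -> /IH.
rewrite (IH _ hp) free_endo_form; congr flatten; apply: eq_map => i /=.
rewrite eM eqxx ev catA -map_cat; congr (map _ _ ++ _).
by rewrite /output -cats1 pmap_cat /=; case: (e.1.2 i).
Qed.

Lemma deriveP r : exists u v, derive r = form u v /\
  match v with
  | Some v => exists2 p, walk (start M) p v & u =1 output p
  | None => exists2 p, accepting_path (start M) p & u =1 output p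
  end.
Proof.
elim: r => [|b r [u [v [IH hv]]]].
  by exists (fun=> [::]), (Some (start M)); split=> //; exists [::] => //=.
rewrite /= IH free_endo_form; case: v hv {IH} => [v|] hv; last first.
  by exists u, None.
have [p hp up] := hv.
have same : exists u0 v0, form u (Some v) = form u0 v0 /\ match v0 with
    | Some v => exists2 p, walk (start M) p v & u0 =1 output p
    | None => exists2 p, accepting_path (start M) p & u0 =1 output p end.
  by exists u, (Some v).
case: b => [e|] /=.
  case h: ((e \in edges M) && (e.1.1 == v)); last exact: same.
  case/andP: h => eM /eqP ev.
  exists (output (rcons p e)), (Some e.2); split; last first.
    by exists (rcons p e) => //; apply: walk_rcons; rewrite ?ev.
  congr flatten; apply: eq_map => i; rewrite catA -map_cat up.
  congr (map _ _ ++ _).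
  by rewrite /output -cats1 pmap_cat /=; case: (e.1.2 i).
case vM: (v \in accept M); last exact: same.
by exists u, None; split=> //; exists p => //; apply/accepting_walk; exists v.
Qed.

Lemma form_final (u : n.+1.-tuple (seq A)) (f : 'I_n.+1 -> seq A) :
  (forall i, tnth u i = f i) -> form f None = map inl (proj_words u).
Proof.
move=> uf; rewrite /form /proj_words map_flatten -[in RHS](map_tnth_enum u).
rewrite -map_comp; congr flatten; apply: eq_map => i.
by rewrite /= uf cats0.
Qed.

(** As long as the run is not over, coordinate [ord0] carries a nonterminal, so the sentential form
    is not a terminal word. *)
Lemma map_inl_form (w : seq A) u v : map inl w = form u (Some v) -> False.
Proof.
move=> h; have : inr (ord0, v) \in (map inl w : seq C).
  rewrite h; apply/flatten_mapP; exists ord0; rewrite ?mem_enum //.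
  by rewrite mem_cat mem_head orbT.
by case/mapP.
Qed.

Lemma async_EDT0L :
  EDT0L (@proj_words n.+1 A @` [set u | accepts M u]).
Proof.
exists C, inl, (form (fun=> [::]) (Some (start M))), (option E), rewrite_edge.
exists setT; split=> [x y []//||].
  exists (@Dfa (option E) unit tt (fun _ _ => tt) [set: unit]).
  by apply/seteqP; split=> // r _ /=; rewrite inE.
apply/seteqP; split=> w /=.
  case=> u [p [/[dup] hp /accepting_walk[v vM hv] up]] <-.
  exists (None :: rev (map Some p)) => //=.
  rewrite -/(derive _) (derive_walk hv) free_endo_form /= vM.
  by rewrite -(form_final up).
case=> r _; rewrite -/(derive r); have [u [v [-> hv]]] := deriveP r.
case: v hv => [v _ /map_inl_form//|[p hp up] H].
exists [tuple u i | i < n.+1]; first by exists p; split=> // i; rewrite tnth_mktuple.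
move: H; rewrite (@form_final [tuple u i | i < n.+1]) => [|i].
  by move/(inj_map inl_inj).
by rewrite tnth_mktuple.
Qed.

End AsyncToEDT0L.

Lemma n_regular_EDT0L n (A : finType) (L : set (n.+1.-tuple (seq A))) :
  n_regular L -> EDT0L (@proj_words n.+1 A @` L).
Proof. by case=> M ->; apply: async_EDT0L. Qed.

(** * Automata that emit a base word and then loop through period words *)

Section LoopAutomaton.
Local Open Scope nat_scope.
Variables (n : nat) (A : finType).
Let L : finType := ('I_n * A)%type.

(** A word over [L] is an interleaving of [n] words: each letter carries the index of the coordinate
    on which it is written. *)
Definition tape (i : 'I_n) (s : seq L) : seq A :=
  pmap (fun x => if x.1 == i then Some x.2 else None) s.

Lemma tape_cat i s s' : tape i (s ++ s') = tape i s ++ tape i s'.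
Proof. exact: pmap_cat. Qed.

(** Each specification consists of an initial word and of the words that may follow it, in any
    number and order. *)
Variable specs : seq (seq L * seq (seq L)).

Let spec (l : 'I_(size specs)) : seq L * seq (seq L) := tnth (in_tuple specs) l.

(** Bounding the length of the pending word makes the vertex type finite. *)
Let bound : nat :=
  \max_(l <- specs) maxn (size l.1) (\max_(p <- l.2) size p).

(* Vertex [Some (l, s)] means that the word [s] has yet to be emitted in the
   component of the [l]-th specification; [None] is the start vertex. *)
Definition loop_vertex : finType := option ('I_(size specs) * bound.-bseq L).

Definition no_letter : {ffun 'I_n -> option A} := [ffun=> None].
Definition one_letter (x : L) : {ffun 'I_n -> option A} :=
  [ffun i => if x.1 == i then Some x.2 else None].

Definition loop_edge (e : async_edge n A loop_vertex) : bool :=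
  match e.1.1, e.2 with
  | None, Some (l, s) => (e.1.2 == no_letter) && (s == (spec l).1 :> seq L)
  | Some (l, s), Some (l', s') => (l' == l) &&
      (if (s : seq L) is x :: s0 then (e.1.2 == one_letter x) && (s0 == s')
       else (e.1.2 == no_letter) && ((s' : seq L) \in (spec l).2))
  | _, None => false
  end.

Lemma card_no_letter : #|[pred i | no_letter i != None]| <= 1.
Proof. by rewrite eq_card0 // => i; rewrite !inE ffunE. Qed.

Lemma card_one_letter x : #|[pred i | one_letter x i != None]| <= 1.
Proof.
rewrite -(card1 x.1); apply: subset_leq_card; apply/fintype.subsetP => i.
by rewrite !inE ffunE [i == _]eq_sym; case: ifP.
Qed.

Lemma loop_edge_label (e : async_edge n A loop_vertex) :
  e \in finset loop_edge -> #|[pred i | e.1.2 i != None]| <= 1.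
Proof.
rewrite inE => he.
have [->|[x ->]] : e.1.2 = no_letter \/ exists x, e.1.2 = one_letter x.
- case: e he => [[[[l [[|x s] hs]]|] lab] [[l' s']|]] //=.
  + by case/and3P=> _ /eqP/= -> _; left.
  + by case/and3P=> _ /eqP/= -> _; right; exists x.
  + by case/andP=> /eqP/= -> _; left.
- exact: card_no_letter.
- exact: card_one_letter.
Qed.

Definition loop_automaton : async_automaton n A :=
  AsyncAutomaton loop_edge_label None
    [set v : loop_vertex | if v is Some (_, s) then nilp s else false].

Definition output_tuple (s : seq L) : n.-tuple (seq A) :=
  [tuple tape i s | i < n].

Let outputs (p : seq (async_edge n A loop_vertex)) i :=
  pmap (fun e : async_edge n A loop_vertex => e.1.2 i) p.

Lemma loop_automaton_sound l (s : bound.-bseq L) p :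
  accepting_path (M := loop_automaton) (Some (l, s)) p ->
  exists2 qs : seq (seq L), {subset qs <= (spec l).2} &
    forall i, outputs p i = tape i (s ++ flatten qs).
Proof.
elim: p l s => [|e p IH] l s /=.
  by rewrite inE => /nilP s0; exists [::] => // i; rewrite s0.
rewrite inE; case: e => [[v lab] [[l' s']|]] /=; last by case: v => // -[].
case/and3P=> + /eqP vE; rewrite {v}vE /loop_edge /=.
case: s => -[|x s] hs /= /and3P[/eqP-> /eqP-> h] /IH[qs qss out].
  exists ((s' : seq L) :: qs) => [q|i]; last by rewrite ffunE out.
  by rewrite inE => /orP[/eqP->|/qss].
exists qs => // i; rewrite ffunE out (eqP h) /tape /=.
by case: ifP.
Qed.

Lemma loop_automaton_emit l (s : seq L) p : size s <= bound ->
  accepting_path (M := loop_automaton) (Some (l, [bseq])) p ->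
  exists2 p', accepting_path (M := loop_automaton)
                (Some (l, insub_bseq bound s)) p' &
    forall i, outputs p' i = tape i s ++ outputs p i.
Proof.
move=> + hp; elim: s => [|x s IH] hs.
  exists p => //; congr accepting_path: hp; congr (Some (_, _)).
  by apply: val_inj; rewrite val_insubd.
have [p' hp' out] := IH (ltnW hs).
exists ((Some (l, insub_bseq bound (x :: s)), one_letter x,
         Some (l, insub_bseq bound s)) :: p') => [|i] /=.
  by rewrite hp' !inE /loop_edge /= !val_insubd hs (ltnW hs) !eqxx.
by rewrite ffunE out /tape /=; case: ifP.
Qed.

Lemma size_spec l : size (spec l).1 <= bound.
Proof.
apply: leq_trans (leq_bigmax_seq (spec l) _ _) => //; last exact: mem_tnth.
exact: leq_maxl.
Qed.

Lemma size_spec_loop l p : p \in (spec l).2 -> size p <= bound.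
Proof.
move=> hp; apply: leq_trans (leq_bigmax_seq (spec l) _ _) => //; last exact: mem_tnth.
apply: leq_trans (leq_maxr _ _); exact: leq_bigmax_seq.
Qed.

Lemma loop_automaton_loops l (qs : seq (seq L)) : {subset qs <= (spec l).2} ->
  exists2 p, accepting_path (M := loop_automaton) (Some (l, [bseq])) p &
    forall i, outputs p i = tape i (flatten qs).
Proof.
elim: qs => [|q qs IH] hqs; first by exists [::] => //=; rewrite inE.
have [|p hp out] := IH; first by move=> r rq; apply: hqs; rewrite inE rq orbT.
have ql : q \in (spec l).2 by apply: hqs; rewrite mem_head.
have [p' hp' out'] := loop_automaton_emit (size_spec_loop ql) hp.
exists ((Some (l, [bseq]), no_letter, Some (l, insub_bseq bound q)) :: p')
  => [|i] /=.
  by rewrite hp' !inE /loop_edge /= val_insubd (size_spec_loop ql) ql !eqxx.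
by rewrite ffunE out' out tape_cat.
Qed.

Lemma n_regular_loops : n_regular
  [set u | exists2 l, l \in specs & exists2 qs : seq (seq L),
     {subset qs <= l.2} & u = output_tuple (l.1 ++ flatten qs)].
Proof.
exists loop_automaton; apply/seteqP; split=> u /=.
  case=> l /(tnthP (in_tuple specs))[i ->] [qs hqs ->].
  have [p hp out] := loop_automaton_loops hqs.
  have [p' hp' out'] := loop_automaton_emit (size_spec i) hp.
  exists ((None, no_letter, Some (i, insub_bseq bound (spec i).1)) :: p').
  split=> [|j] /=.
    by rewrite hp' !inE /loop_edge /= val_insubd (size_spec i) !eqxx.
  by rewrite tnth_mktuple ffunE tape_cat -out -out'.
case=> -[|e p] [] /=; first by rewrite inE.
rewrite inE; case: e => [[v lab] [[l s]|]] /=; last by case: v => // -[].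
case/and3P=> + /eqP vE; rewrite {v}vE /loop_edge /= => /andP[/eqP-> /eqP hs].
move=> /loop_automaton_sound[qs hqs out] hu.
exists (spec l); first exact: mem_tnth.
exists qs => //; apply: eq_from_tnth => i.
by rewrite hu /= ffunE tnth_mktuple -hs -out.
Qed.

End LoopAutomaton.

(** * Normal forms *)

Lemma star_sumP (V : zmodType) (ps : seq V) (v : V) :
  star (fun x => x \in ps) v <->
  exists2 qs : seq V, {subset qs <= ps} & v = \sum_(q <- qs) q.
Proof.
split.
  elim=> [|x w xp _ [qs hqs ->]]; first by exists [::]; rewrite ?big_nil.
  exists (x :: qs); last by rewrite big_cons.
  by move=> q; rewrite inE => /orP[/eqP->|/hqs].
case=> qs + ->; elim: qs => [|q qs IH] hqs; first by rewrite big_nil; apply: star0.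
rewrite big_cons; apply: starS; first by apply: hqs; rewrite mem_head.
by apply: IH => r rq; apply: hqs; rewrite inE rq orbT.
Qed.

Section NormalForms.
Variables (k : nat) (J : finType).
Let A : finType := letter k J.
Implicit Types (z b p : {ffun 'I_k -> int}) (sigma : {ffun 'I_k -> bool}).

Definition nf_word z (j : J) (i : 'I_k.+1) : seq A :=
  if unlift ord_max i is Some i' then nseq (absz (z i')) (inl (i', z i' < 0))
  else [:: inr j].

Definition nf z (j : J) : k.+1.-tuple (seq A) :=
  [tuple nf_word z j i | i < k.+1].

Lemma widen_lift (i : 'I_k) : widen_ord (leqnSn k) i = lift ord_max i.
Proof. by apply: val_inj; rewrite /= /bump leqNgt ltn_ord. Qed.

Lemma NF_tupleP (u : k.+1.-tuple (seq A)) :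
  NF_tuple u <-> exists z j, u = nf z j.
Proof.
split=> [[hu [j uj]]|[z [j ->]]]; last first.
  split=> [i|].
    exists (z i < 0), (absz (z i)).
    by rewrite tnth_mktuple widen_lift /nf_word liftK.
  by exists j; rewrite tnth_mktuple /nf_word unlift_none.
have /choice[f hf] (i : 'I_k) : exists bm : bool * nat,
    tnth u (widen_ord (leqnSn k) i) = nseq bm.2 (inl (i, bm.1)).
  by have [b [m h]] := hu i; exists (b, m).
exists [ffun i => if (f i).1 then - (f i).2%:Z else (f i).2%:Z], j.
apply: eq_from_tnth => i; rewrite tnth_mktuple /nf_word.
case: unliftP => [i' ->|->]; last exact: uj.
(* The exponent 0 forgets the sign bit, but then the word is empty for either sign. *)
rewrite -widen_lift hf ffunE; by case: (f i') => -[] [|m].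
Qed.

Lemma word_val_nf (G : groupType) (a : 'I_k -> G) (t : J -> G) z j :
  word_val (letter_val a t) (proj_words (nf z j)) =
  ((\prod_(i < k) zexpg (a i) (z i)) * t j)%g.
Proof.
have prod_nseq (x : A) m :
    (\prod_(y <- nseq m x) letter_val a t y = letter_val a t x ^+ m)%g.
  elim: m => [|m IH]; first by rewrite big_nil.
  by rewrite big_cons IH expgS.
rewrite /word_val /proj_words -map_tnth_enum big_flatten /= big_map.
rewrite (_ : enum _ = index_enum _); last by rewrite [RHS]unlock enumT.
rewrite big_ord_recr /= !tnth_mktuple; congr (_ * _)%g.
  apply: eq_bigr => i _.
  rewrite tnth_mktuple widen_lift /nf_word liftK prod_nseq /=.
  by case: (z i) => m //=; rewrite expVgn.
by rewrite /nf_word unlift_none big_seq1.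
Qed.

(** The signs are read off [sigma] instead of [z], so that all vectors of one orthant use the same
    letters, also where a coordinate vanishes. *)
Definition emission sigma z : seq ('I_k.+1 * A) :=
  flatten [seq nseq (absz (z i)) (lift ord_max i, inl (i, sigma i))
          | i <- enum 'I_k].

Lemma tape_nseq (i : 'I_k.+1) m (x : 'I_k.+1 * A) :
  tape i (nseq m x) = if x.1 == i then nseq m x.2 else [::].
Proof.
by elim: m => [|m IH]; rewrite /tape /=; case: ifP => // h; rewrite /= -/(tape _ _) IH h.
Qed.

Lemma tape_emission sigma z (i : 'I_k) :
  tape (lift ord_max i) (emission sigma z) =
  nseq (absz (z i)) (inl (i, sigma i)).
Proof.
rewrite /emission.
have : i \in enum 'I_k by rewrite mem_enum.
elim: (enum 'I_k) (enum_uniq 'I_k) => //= h s IH /andP[hs us].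
rewrite tape_cat tape_nseq (inj_eq lift_inj) /= inE => /orP[/eqP ih|si].
  subst h; rewrite eqxx -[RHS]cats0; congr (_ ++ _).
  elim: s hs {IH us} => //= h s IH; rewrite inE negb_or => /andP[ih /IH hs].
  by rewrite tape_cat tape_nseq (inj_eq lift_inj) eq_sym (negPf ih) hs.
rewrite (IH us si); case: eqP => // hi.
by move: hs; rewrite hi si.
Qed.

Lemma tape_emission_max sigma z : tape ord_max (emission sigma z) = [::].
Proof.
rewrite /emission; elim: (enum _) => //= h s IH.
by rewrite tape_cat tape_nseq eq_sym (negPf (neq_lift _ _)) IH.
Qed.

(** Absolute values add up within an orthant: no letter meets its inverse, so concatenated emissions
    are again in normal form. This is why linear sets are kept inside orthants. *)
Lemma emissionD sigma y z i : in_orthant sigma y -> in_orthant sigma z ->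
  tape i (emission sigma (y + z)) =
  tape i (emission sigma y) ++ tape i (emission sigma z).
Proof.
move=> hy hz; case: (unliftP ord_max i) => [i' ->|->]; last first.
  by rewrite !tape_emission_max.
rewrite !tape_emission -nseqD; congr (nseq _ _); rewrite ffunE.
move: (hy i') (hz i'); move: (y i') (z i') => q r.
by case: ifP; lia.
Qed.

Lemma in_orthantD sigma y z :
  in_orthant sigma y -> in_orthant sigma z -> in_orthant sigma (y + z).
Proof.
move=> hy hz i; move: (hy i) (hz i); rewrite ffunE; move: (y i) (z i) => q r.
by case: ifP; lia.
Qed.

(** The transversal letter, though last in the tuple, may be emitted first, because only the order
    on each tape matters. *)
Lemma nf_emission sigma z j : in_orthant sigma z ->
  nf z j = output_tuple ((ord_max, inr j) :: emission sigma z).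
Proof.
move=> hz; apply: eq_from_tnth => i; rewrite !tnth_mktuple /nf_word /tape /=.
case: unliftP => [i' ->|->]; last first.
  by rewrite eqxx /= -/(tape _ _) tape_emission_max.
rewrite (negPf (neq_lift _ _)) /= -/(tape _ _) tape_emission.
have := hz i'; case: (z i') => [[|m]|m] //=; case: (sigma i') => //; lia.
Qed.

Lemma tape_emissions sigma (ps qs : seq {ffun 'I_k -> int}) i :
  (forall p, p \in ps -> in_orthant sigma p) -> {subset qs <= ps} ->
  in_orthant sigma (\sum_(q <- qs) q) /\
  tape i (emission sigma (\sum_(q <- qs) q)) =
  tape i (flatten (map (emission sigma) qs)).
Proof.
move=> hps; elim: qs => [|q qs IH] hqs.
  rewrite big_nil; split=> [j|]; first by rewrite ffunE; case: ifP.
  case: (unliftP ord_max i) => [i' ->|->]; last by rewrite tape_emission_max.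
  by rewrite tape_emission ffunE.
have [|hs IHs] := IH; first by move=> r rq; apply: hqs; rewrite inE rq orbT.
have hq : in_orthant sigma q by apply: hps; apply: hqs; rewrite mem_head.
rewrite big_cons; split; first exact: in_orthantD.
by rewrite emissionD //= tape_cat IHs.
Qed.

Lemma n_regular_nf (P : J -> {ffun 'I_k -> int} -> Prop) :
  (forall j, qf (P j)) ->
  n_regular [set u | exists z j, u = nf z j /\ P j z].
Proof.
move=> hP; have /choice[L hL] j := qf_linear_sets (hP j).
pose em sigma := emission sigma.
(* One specification for each coset and linear set: the base gives the initial word and the periods
   give the loops. *)
pose specs : seq (seq ('I_k.+1 * A) * seq (seq ('I_k.+1 * A))) :=
  flatten [seq [seq ((ord_max, inr j) :: em l.1.1 l.1.2, map (em l.1.1) l.2)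
               | l <- L j] | j <- enum J].
have [M hM] := n_regular_loops specs; exists M; rewrite -{}hM.
have emit j l qs : l \in L j -> {subset qs <= l.2} ->
    nf (l.1.2 + \sum_(q <- qs) q) j =
    output_tuple (((ord_max, inr j) :: em l.1.1 l.1.2) ++
                  flatten (map (em l.1.1) qs)).
  move=> lL hqs; have [/(_ l lL)[hb hp] _] := hL j.
  have [hs _] := tape_emissions ord_max hp hqs.
  rewrite (nf_emission j (in_orthantD hb hs)).
  apply: eq_from_tnth => i; rewrite !tnth_mktuple.
  have [_ e] := tape_emissions i hp hqs.
  rewrite -cat1s tape_cat -[in RHS]cat1s -catA !tape_cat emissionD //.
  by rewrite e.
apply/seteqP; split=> u /=.
  case=> z [j [-> Pz]]; have [_ /(_ z)[/(_ Pz)[l lL]]] := hL j.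
  case/star_sumP=> qs hqs hz _.
  exists ((ord_max, inr j) :: em l.1.1 l.1.2, map (em l.1.1) l.2).
    apply/flatten_mapP; exists j; rewrite ?mem_enum //.
    by apply: (map_f (fun l => (_ :: em l.1.1 l.1.2, map (em l.1.1) l.2))).
  exists (map (em l.1.1) qs).
    by move=> _ /mapP[q /hqs ql ->]; apply: map_f.
  by rewrite -emit // -hz addrC subrK.
case=> _ /flatten_mapP[j _ /mapP[l lL ->]] [ws /= hws ->].
have [qs [hqs ->]] : exists qs, {subset qs <= l.2} /\ ws = map (em l.1.1) qs.
  elim: ws hws => [|w ws IH] hws; first by exists [::].
  have [|qs [hqs ->]] := IH; first by move=> r rw; apply: hws; rewrite inE rw orbT.
  have /mapP[q ql ->] : w \in map (em l.1.1) l.2 by apply: hws; rewrite mem_head.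
  by exists (q :: qs); split=> // r; rewrite inE => /orP[/eqP->|/hqs].
exists (l.1.2 + \sum_(q <- qs) q), j; split; first by rewrite emit.
have [_ h] := hL j; apply/h; exists l => //; apply/star_sumP.
by exists qs => //; rewrite addrC addKr.
Qed.

Lemma qf_n_regular_EDT0L_NF (G : groupType) (a : 'I_k -> G) (t : J -> G)
    (U : set G) :
  (forall j, qf (fun z => U ((\prod_(i < k) zexpg (a i) (z i)) * t j)%g)) ->
  n_regular_EDT0L_NF a t U.
Proof.
move=> hU.
have h : n_regular (NF_of a t U).
  have [M hM] := n_regular_nf hU; exists M; rewrite -hM.
  apply/seteqP; split=> u /=.
    case=> /NF_tupleP[z [j ->]] /=; rewrite word_val_nf => Uz.
    by exists z, j.
  case=> z [j [-> Uz]]; split; first by apply/NF_tupleP; exists z, j.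
  by rewrite /= word_val_nf.
by split=> //; apply: n_regular_EDT0L.
Qed.

End NormalForms.

(** * Definable sets of a virtually abelian group *)

Lemma zexpg_commute (G : groupType) (x y : G) m n :
  commute x y -> commute (zexpg x m) (zexpg y n).
Proof.
move=> xy; have h : commute (zexpg x m) y.
  by case: m => m /=; apply/commute_sym; rewrite -?expVgn; apply: commuteX;
    do ?apply: commuteV; apply: commute_sym.
case: n => n /=; first exact: commuteX.
by apply: commuteV; apply: commuteX.
Qed.

Lemma zexpgD (G : groupType) (x : G) m n :
  zexpg x (m + n) = (zexpg x m * zexpg x n)%g.
Proof.
have S1 u : zexpg x (u + 1) = (zexpg x u * x)%g.
  case: u => [u|[|u]].
  - by rewrite -PoszD addn1 /= expgSr.
  - by rewrite /= expg1 mulVg.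
  - rewrite (_ : Negz u.+1 + 1 = Negz u); last by lia.
    by rewrite /= [in RHS]expgS invgM mulgVK.
have P1 u : zexpg x (u - 1) = (zexpg x u * x^-1)%g.
  by apply: (@mulIg _ x); rewrite -S1 subrK mulgVK.
elim/int_rec: n => [|n IH|n IH].
- by rewrite addr0 mulg1.
- by rewrite -[n.+1]addn1 PoszD addrA !S1 IH mulgA.
- by rewrite -[n.+1]addn1 PoszD opprD addrA !P1 IH mulgA.
Qed.

Lemma subgroup_zexpg (G : groupType) (H : set G) x m :
  is_subgroup H -> H x -> H (zexpg x m).
Proof.
case=> H1 HM HV Hx; have HX n : H (x ^+ n)%g.
  by elim: n => // n IH; rewrite expgS; apply: HM.
by case: m => m /=; last apply: HV.
Qed.

Section VirtuallyAbelian.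
Variables (G : groupType) (k : nat) (a : 'I_k -> G) (J : finType) (t : J -> G).
Hypothesis hat : natural_generators a t.
Implicit Types (z w : {ffun 'I_k -> int}) (i : 'I_k) (j : J).

Definition lattice z : G := (\prod_(i < k) zexpg (a i) (z i))%g.

Lemma latticeD z w : lattice (z + w) = (lattice z * lattice w)%g.
Proof.
have [[comm _] _ _] := hat.
rewrite /lattice -prodgM_commute => [|i i' _ _]; last exact: zexpg_commute.
by apply: eq_bigr => i _; rewrite ffunE zexpgD.
Qed.

Lemma lattice0 : lattice 0 = 1%g.
Proof. by rewrite /lattice big1 // => i _; rewrite ffunE. Qed.

Lemma latticeN z : lattice (- z) = (lattice z)^-1%g.
Proof. by apply: (@mulIg _ (lattice z)); rewrite -latticeD addNr lattice0 mulVg. Qed.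

Lemma lattice_inj : injective lattice.
Proof.
move=> z w zw; have [[_ free] _ _] := hat.
have e1 : lattice (z - w) = 1%g by rewrite latticeD latticeN zw mulgV.
by apply/ffunP => i; have := free _ e1 i; rewrite !ffunE => /eqP; rewrite subr_eq0 => /eqP.
Qed.

Lemma generatedP g : generated (range a) g <-> exists z, g = lattice z.
Proof.
split=> [hg|[z ->] H hH aH]; last first.
  have [H1 HM _] := hH; rewrite /lattice; apply: big_ind => // i _.
  by apply: subgroup_zexpg => //; apply: aH; exists i.
move/(_ (fun g => exists z, g = lattice z)): hg; apply.
  split=> [|_ _ [z ->] [w ->]|_ [z ->]].
  - by exists 0; rewrite lattice0.
  - by exists (z + w); rewrite latticeD.
  - by exists (- z); rewrite latticeN.
move=> _ [i _ <-]; exists [ffun i' => (i' == i)%:R].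
rewrite /lattice (@big_only1 _ _ _ _ i) // => [|i' /negPf i'i _].
  by rewrite ffunE eqxx.
by rewrite ffunE i'i.
Qed.

Definition element z j : G := (lattice z * t j)%g.

Lemma elementP g : exists z j, g = element z j.
Proof.
have [_ _ /(_ g)[j [/generatedP[z zE] _]]] := hat.
by exists z, j; rewrite /element -zE mulgVK.
Qed.

Lemma element_inj z j w j' : element z j = element w j' -> z = w /\ j = j'.
Proof.
move=> e; have [_ _ /(_ (element z j))[j0 [_ uniq]]] := hat.
have jj : j0 = j by apply: uniq; apply/generatedP; exists z; rewrite mulgK.
have jj' : j0 = j'.
  by apply: uniq; rewrite e; apply/generatedP; exists w; rewrite mulgK.
by split; [apply: lattice_inj; move: e; rewrite -jj -jj' => /mulIg | rewrite -jj].
Qed.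

Lemma lattice_scale z n : lattice [ffun i => z i * n] = zexpg (lattice z) n.
Proof.
have SX m : lattice [ffun i => z i * m%:Z] = (lattice z ^+ m)%g.
  elim: m => [|m IH].
    by rewrite expg0 -lattice0; congr lattice; apply/ffunP => i; rewrite !ffunE mulr0.
  rewrite expgSr -IH -latticeD; congr lattice; apply/ffunP => i.
  by rewrite !ffunE -[m.+1]addn1 PoszD mulrDr mulr1.
case: n => m /=; first exact: SX.
rewrite -SX -latticeN; congr lattice; apply/ffunP => i.
by rewrite !ffunE NegzE mulrN.
Qed.

(** Normality sends each [a i] back into the lattice, and conjugation is a homomorphism, so it is
    linear with the images of the basis as coefficients. *)
Lemma lattice_conj g : exists M : {ffun 'I_k -> int} -> {ffun 'I_k -> int},
  (forall i, affine (fun z => M z i)) /\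
    forall z, (lattice z ^ g)%g = lattice (M z).
Proof.
have [_ normal _] := hat.
have /choice[m mE] i : exists w, (a i ^ g)%g = lattice w.
  by apply/generatedP; apply: normal => H _; apply; exists i.
exists (fun z => \sum_i [ffun i' => m i i' * z i]); split=> [i|z].
  apply: (@affine_ext _ (fun z => \sum_i' m i' i * z i')) => [z|].
    by rewrite sum_ffunE; apply: eq_bigr => i' _; rewrite ffunE.
  by apply: affine_sum => i'; apply: affine_scale; apply: affine_var.
rewrite (big_morph lattice latticeD lattice0) {1}/lattice conjg_prod.
apply: eq_bigr => i _; rewrite lattice_scale -mE.
by case: (z i) => n /=; rewrite ?conjVg conjXg.
Qed.

Definition coset_qf (U : set G) : Prop :=
  forall j, qf (fun z => U (element z j)).

(** * Translation of first-order logic over the group into Presburger arithmetic *)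

Section Environments.
Variable Q : finType.
Implicit Types (f : Q -> J) (x y : {ffun Q * 'I_k -> int}).

(** Once the cosets [f] of the variables are fixed, each variable in [G] amounts to [k] integer
    variables. *)
Definition environment f x (c : Q) : G := element [ffun i => x (c, i)] (f c).

(** The coset of the value depends only on the cosets of the arguments, and its lattice part is
    affine in theirs. *)
Definition gaffine (F : (Q -> G) -> G) : Prop := forall f,
  exists j (L : {ffun Q * 'I_k -> int} -> {ffun 'I_k -> int}),
    (forall i, affine (fun x => L x i)) /\
    forall x, F (environment f x) = element (L x) j.

Lemma gaffine_var c : gaffine (fun e => e c).
Proof.
move=> f; exists (f c), (fun x => [ffun i => x (c, i)]); split=> // i.
by apply: affine_ext (affine_var (c, i)) => x; rewrite ffunE.
Qed.

Lemma gaffine_const g : gaffine (fun=> g).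
Proof.
move=> f; have [w [j ->]] := elementP g; exists j, (fun=> w); split=> // i.
exact: affine_const.
Qed.

Lemma gaffine_mul F F' : gaffine F -> gaffine F' ->
  gaffine (fun e => F e * F' e)%g.
Proof.
move=> hF hF' f; have [j [L [hL LE]]] := hF f; have [j' [L' [hL' L'E]]] := hF' f.
(* For lattice elements z and z', [z t_j z' t_j'] equals z times the conjugate [t_j z' t_j^-1] times
   [t_j t_j']; the last factor is a constant. *)
have [M [hM ME]] := lattice_conj (t j)^-1%g.
have [w [j0 tE]] := elementP (t j * t j')%g.
exists j0, (fun x => L x + M (L' x) + w); split=> [i|x].
  apply: (@affine_ext _ (fun x => L x i + M (L' x) i + w i)) => [x|].
    by rewrite !ffunE.
  apply: affine_add (affine_const _ _); apply: affine_add => //.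
  exact: (affine_comp (hM i)).
rewrite LE L'E /element !latticeD -ME -(mulgA _ (lattice w)).
rewrite [(lattice w * _)%g](esym tE) conjgE invgK.
by rewrite !mulgA mulgVK.
Qed.

Lemma gaffine_inv F : gaffine F -> gaffine (fun e => (F e)^-1)%g.
Proof.
move=> hF f; have [j [L [hL LE]]] := hF f.
(* The inverse of [z t_j] is the conjugate [t_j^-1 z^-1 t_j] times the constant [t_j^-1]. *)
have [M [hM ME]] := lattice_conj (t j)%g.
have [w [j0 tE]] := elementP (t j)^-1%g.
exists j0, (fun x => M (- L x) + w); split=> [i|x].
  apply: (@affine_ext _ (fun x => M (- L x) i + w i)) => [x|].
    by rewrite !ffunE.
  apply: affine_add (affine_const _ _); apply: (affine_comp (hM i)) => i'.
  by apply: affine_ext (affine_opp (hL i')) => x; rewrite ffunE.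
rewrite LE /element latticeD -ME latticeN -mulgA.
by rewrite [(lattice w * _)%g](esym tE) conjgE invgM -!mulgA mulgV mulg1.
Qed.

Implicit Types U : (Q -> G) -> Prop.

Definition gdefinable U : Prop :=
  forall f, qf (fun x => U (environment f x)).

Lemma gdefinable_ext U U' : (forall e, U e <-> U' e) -> gdefinable U ->
  gdefinable U'.
Proof. by move=> UU' hU f; apply: qf_ext (hU f) => x. Qed.

Lemma gdefinable_not U : gdefinable U -> gdefinable (fun e => ~ U e).
Proof. by move=> hU f; apply: qf_not. Qed.

Lemma gdefinable_and U U' : gdefinable U -> gdefinable U' ->
  gdefinable (fun e => U e /\ U' e).
Proof. by move=> hU hU' f; apply: qf_and. Qed.

Lemma gdefinable_or U U' : gdefinable U -> gdefinable U' ->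
  gdefinable (fun e => U e \/ U' e).
Proof. by move=> hU hU' f; apply: qf_or. Qed.

Lemma gdefinable_imp U U' : gdefinable U -> gdefinable U' ->
  gdefinable (fun e => U e -> U' e).
Proof. by move=> hU hU' f; apply: qf_imp. Qed.

Lemma gdefinable_eq F F' : gaffine F -> gaffine F' ->
  gdefinable (fun e => F e = F' e).
Proof.
move=> hF hF' f; have [j [L [hL LE]]] := hF f; have [j' [L' [hL' L'E]]] := hF' f.
have h : qf (fun x => j = j' /\ forall i, L x i = L' x i).
  by apply: qf_and (qf_const _ _) _; apply: qf_all_fin => i; apply: qf_eq.
apply: qf_ext h => x; rewrite LE L'E; split=> [[-> /ffunP->]//|].
by move=> /element_inj[-> ->].
Qed.

Lemma gdefinable_unary (U : set G) F : coset_qf U -> gaffine F ->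
  gdefinable (fun e => U (F e)).
Proof.
move=> hU hF f; have [j [L [hL LE]]] := hF f.
by apply: qf_ext (qf_comp hL (hU j)) => x; rewrite LE.
Qed.

End Environments.

Lemma gdefinable_comp (Q Q' : finType) (U : (Q -> G) -> Prop)
    (F : (Q' -> G) -> Q -> G) :
  (forall c, gaffine (fun e => F e c)) -> gdefinable U ->
  gdefinable (fun e => U (F e)).
Proof.
move=> hF hU f; have /choice[js hjs] c := hF c f; have /choice[L hL] := hjs.
pose h x : {ffun Q * 'I_k -> int} := [ffun y => L y.1 x y.2].
have hh y : affine (fun x => h x y).
  have [hLy _] := hL y.1; apply: affine_ext (hLy y.2) => x; rewrite ffunE //.
apply: qf_ext (qf_comp hh (hU js)) => x.
suff -> : environment js (h x) = F (environment f x) by [].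
apply: funext => c; have [_ ->] := hL c; congr element.
by apply/ffunP => i; rewrite !ffunE.
Qed.

(** A quantifier over [G] is a finite disjunction over the coset of the bound element, followed by a
    block of [k] integer quantifiers. *)
Lemma gdefinable_ex n (U : ('I_n.+1 -> G) -> Prop) : gdefinable U ->
  gdefinable (fun e : 'I_n -> G => exists g, U (env_cons g e)).
Proof.
move=> hU f.
pose h (x : {ffun 'I_n * 'I_k -> int}) w : {ffun 'I_n.+1 * 'I_k -> int} :=
  [ffun y => if unlift ord0 y.1 is Some c then x (c, y.2) else w y.2].
have hh y : affine (fun e : {ffun 'I_n * 'I_k + 'I_k -> int} =>
    h [ffun x => e (inl x)] [ffun i => e (inr i)] y).
  case yE: (unlift ord0 y.1) => [c|].
    by apply: affine_ext (affine_var (inl (c, y.2))) => e; rewrite ffunE yE ffunE.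
  by apply: affine_ext (affine_var (inr y.2)) => e; rewrite ffunE yE ffunE.
have hE j x w :
    environment (env_cons j f) (h x w) = env_cons (element w j) (environment f x).
  apply: funext => c; rewrite /environment /env_cons.
  by case cE: (unlift ord0 c) => [c'|]; congr element; apply/ffunP => i;
    rewrite !ffunE /= cE.
apply: qf_ext (qf_ex_fin (fun j => qf_ex_block hh (hU (env_cons j f)))) => x.
split=> [[j [w]]|[g]]; first by rewrite hE => ?; exists (element w j).
by have [w [j ->]] := elementP g => Ug; exists j, w; rewrite hE.
Qed.

Lemma gdefinable_all n (U : ('I_n.+1 -> G) -> Prop) : gdefinable U ->
  gdefinable (fun e : 'I_n -> G => forall g, U (env_cons g e)).
Proof.
move=> /gdefinable_not/gdefinable_ex/gdefinable_not; apply: gdefinable_ext => e.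
by rewrite -forallNE; split=> h g; [apply: contrapT | move/(_ (h g))].
Qed.

Lemma gaffine_teval n (u : gterm n) : gaffine (fun e : 'I_n -> G => teval e u).
Proof.
elim: u => [i||u1 h1 u2 h2|u h] /=.
- exact: gaffine_var.
- exact: gaffine_const.
- exact: gaffine_mul.
- exact: gaffine_inv.
Qed.

Lemma gdefinable_holds n (F : gformula n) :
  gdefinable (fun e : 'I_n -> G => holds F e).
Proof.
elim: F => [m u v|m F IH|m F IH F' IH'|m F IH F' IH'|m F IH F' IH'|m F IH|m F IH] /=.
- by apply: gdefinable_eq; apply: gaffine_teval.
- exact: gdefinable_not.
- exact: gdefinable_and.
- exact: gdefinable_or.
- exact: gdefinable_imp.
- exact: gdefinable_all.
- exact: gdefinable_ex.
Qed.

Lemma coset_qf_gdefinable (U : ('I_1 -> G) -> Prop) :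
  gdefinable U -> coset_qf (fun g => U (fun=> g)).
Proof.
move=> hU j.
pose h z : {ffun 'I_1 * 'I_k -> int} := [ffun y => z y.2].
have hh y : affine (fun z => h z y).
  by apply: affine_ext (affine_var y.2) => z; rewrite ffunE.
apply: qf_ext (qf_comp hh (hU (fun=> j))) => z.
suff -> : environment (fun=> j) (h z) = fun=> element z j by [].
by apply: funext => c; congr element; apply/ffunP => i; rewrite !ffunE.
Qed.

End VirtuallyAbelian.

(** * The six families of sets *)

Lemma affine_combination (X : finType) (f : {ffun X -> int} -> int) x y z :
  affine f -> f (x - y + z) = f x - f y + f z.
Proof.
case=> l fE; have aff u v : f (u + v) = f u + linear_part l v.
  by rewrite !fE aff_evalD.
have e : f x = f y + linear_part l (x - y) by rewrite -aff addrC subrK.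
by rewrite addrC aff e [f y + _]addrC addrK addrC.
Qed.

Section Representatives.
Variables (G : groupType) (k : nat) (a : 'I_k -> G) (J : finType) (t : J -> G).
Hypothesis hat : natural_generators a t.
Implicit Types (z : {ffun 'I_k -> int}) (j : J).

Local Notation element := (element a t).
Local Notation coset_qf := (coset_qf a t).
Local Notation gdefinable := (gdefinable a t).
Local Notation gaffine := (gaffine a t).

(** With the coset fixed, the combination [x - y + z] of vectors corresponds to the product of the
    first element, the inverse of the second and the third. *)
Lemma coset_qf_subgroup (H : set G) : is_subgroup H -> coset_qf H.
Proof.
case=> _ HM HV j; apply: qf_affine_closed => x y z hx hy hz.
have -> : element (x - y + z) j =
    (element x j * (element y j)^-1 * element z j)%g.
  rewrite /element !(latticeD hat) (latticeN hat) invgM !mulgA mulgK.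
  by rewrite -[(lattice a x * _ * _)%g]mulgA.
by apply: (HM) => //; apply: (HM) => //; apply: (HV).
Qed.

(** * Rational sets as path sums *)

Section Rational.
Variables (S : finType) (s : S -> G) (M : dfa S).

(** A vertex records the automaton state and the current coset. Rewriting [t p.2 * s x] with its
    lattice part on the left makes the labels along a path simply add up. The loops labelled 0
    represent the empty word, since paths have at least one edge. *)
Definition coset_edge (p q : dfa_state M * J) (v : {ffun 'I_k -> int}) : Prop :=
  (p = q /\ v = 0) \/
  exists x, q.1 = dfa_next p.1 x /\ (t p.2 * s x)%g = element v q.2.

Lemma semilinear_coset_edge p q : semilinear_set (coset_edge p q).
Proof.
(* Each letter determines at most one label between two given vertices, so only singletons and the
   empty set occur. *)
have single (P : {ffun 'I_k -> int} -> Prop) :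
    (forall v w, P v -> P w -> v = w) -> semilinear_set P.
  move=> uniq; have [[v Pv]|nP] := pselect (exists v, P v).
    apply: semilinear_ext (semilinear1 v) => w.
    by split=> [->//|Pw]; apply: uniq.
  apply: semilinear_ext (@semilinear0 _) => w; split=> // Pw.
  by case: nP; exists w.
apply: semilinearU; first by apply: single => v w [_ ->] [_ ->].
apply: semilinear_ex_fin => x; apply: single => v w [_ ev] [_ ew].
by move: ew; rewrite ev => /(element_inj hat)[].
Qed.

Lemma path_sum_word V p q v : path_sum coset_edge V p q v ->
  exists w : seq S, foldl (@dfa_next _ M) p.1 w = q.1 /\
    (t p.2 * word_val s w)%g = element v q.2.
Proof.
elim=> {p q v} [p q v|p r q u v hpr _ _ [w [hw ew]]].
  case=> [[-> ->]|[x [-> ex]]].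
    by exists [::]; rewrite /element lattice0 mul1g /word_val big_nil mulg1.
  by exists [:: x]; rewrite /word_val big_seq1.
case: hpr => [[-> ->]|[x [rE ex]]]; first by exists w; rewrite add0r.
exists (x :: w); rewrite /= -rE; split=> //.
rewrite /word_val big_cons mulgA ex /element (latticeD hat) -!mulgA.
by rewrite -/(word_val s w) ew.
Qed.

Lemma word_path_sum (w : seq S) p : exists j v,
  path_sum coset_edge (enum {: dfa_state M * J}) p
    (foldl (@dfa_next _ M) p.1 w, j) v /\
  (t p.2 * word_val s w)%g = element v j.
Proof.
elim: w p => [|x w IH] [p i] /=.
  exists i, 0; split; first by apply: path_edge; left.
  by rewrite /element lattice0 mul1g /word_val big_nil mulg1.
have [u [r ex]] := elementP hat (t i * s x)%g.
have [j [v [hv ew]]] := IH (dfa_next p x, r); exists j, (u + v); split.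
  by apply: path_step hv; [right; exists x | rewrite mem_enum].
rewrite /word_val big_cons mulgA ex /element (latticeD hat) -!mulgA.
by rewrite -/(word_val s w) ew.
Qed.

Lemma coset_qf_dfa :
  coset_qf (word_val s @`
    [set w | foldl (@dfa_next _ M) (dfa_start M) w \in dfa_final M]).
Proof.
(* The representative [t j0] of the lattice itself may differ from 1, so paths start in the coset
   [j0] and the result is translated by [z0]. *)
move=> j; have [z0 [j0 e0]] := elementP hat (1 : G)%g.
have h : qf (fun z => exists q, q \in dfa_final M /\
    path_sum coset_edge (enum {: dfa_state M * J}) (dfa_start M, j0) (q, j)
      (z - z0)).
  apply: qf_ex_fin => q; apply: qf_and (qf_const _ _) _.
  have hs : qf (path_sum coset_edge (enum {: dfa_state M * J})
                  (dfa_start M, j0) (q, j)).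
    by apply/semilinear_qf/semilinear_path_sum => *; apply: semilinear_coset_edge.
  apply: qf_comp hs => i.
  apply: (@affine_ext _ (fun z => z i - z0 i)) => [z|]; first by rewrite !ffunE.
  exact: affine_sub (affine_var i) (affine_const _ _).
have lift (w : seq S) v : (t j0 * word_val s w)%g = element v j ->
    word_val s w = element (z0 + v) j.
  move=> e; rewrite -[LHS]mul1g e0 /element (latticeD hat) -!mulgA.
  by rewrite e.
apply: qf_ext h => z; split.
  case=> q [qF /path_sum_word[w [/= hw /lift ew]]].
  by exists w; rewrite ?ew 1?addrC ?subrK //= hw.
case=> w /= hw ew; have [j' [v [hv /= ev]]] := word_path_sum w (dfa_start M, j0).
exists (foldl (@dfa_next _ M) (dfa_start M) w); split=> //.
have : element z j = element (z0 + v) j'.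
  by rewrite -ew -[LHS]mul1g e0 /element (latticeD hat) -!mulgA ev.
by case/(element_inj hat)=> -> ->; rewrite addrC addKr.
Qed.

End Rational.

Lemma coset_qf_rational (S : finType) (s : S -> G) U :
  rational s U -> coset_qf U.
Proof. by case=> _ [M ->] ->; apply: coset_qf_dfa. Qed.

Lemma gaffine_word_val (Q : finType) (A : Type) (v : A -> (Q -> G) -> G) w :
  (forall x, gaffine (v x)) -> gaffine (fun e => word_val (v^~ e) w).
Proof.
move=> hv; elim: w => [|x w IH].
  have := gaffine_const hat (Q := Q) 1%g; congr gaffine.
  by apply: funext => e; rewrite /word_val big_nil.
have := gaffine_mul hat (hv x) IH; congr gaffine.
by apply: funext => e; rewrite /word_val big_cons.
Qed.

(** On fixed cosets, the left-hand side of each equation has an affine lattice part and a constant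
    coset, so its solutions are closed under [x - y + z]. This closure passes to arbitrary
    intersections, hence to infinite systems. *)
Lemma gdefinable_algebraic q (V : set {ffun 'I_q -> G}) :
  algebraic V -> gdefinable (fun e : 'I_q -> G => V [ffun c => e c]).
Proof.
case=> E -> f; apply: qf_affine_closed => x y z hx hy hz w wE.
pose v (l : 'I_q * bool + G) (e : 'I_q -> G) : G :=
  match l with inl (i, b) => if b then (e i)^-1%g else e i | inr c => c end.
have hv l : gaffine (v l).
  case: l => [[i []]|c].
  - exact: (gaffine_inv hat (gaffine_var _ _ i)).
  - exact: gaffine_var.
  - exact: gaffine_const.
have [j [L [hL LE]]] := gaffine_word_val w hv f.
have solvesE u : solves [ffun c => environment a t f u c] w <->
    element (L u) j = 1%g.
  rewrite -LE /solves; suff -> : word_val (v^~ (environment a t f u)) w =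
    word_val (fun l : 'I_q * bool + G => match l with
      | inl (i, b) => if b then ([ffun c => environment a t f u c] i)^-1%g
                      else [ffun c => environment a t f u c] i
      | inr c => c end) w by [].
  rewrite /word_val; apply: eq_bigr => -[[i b]|c] _ //=.
  by rewrite ffunE.
apply/solvesE; move: (hx w wE) (hy w wE) (hz w wE) => /solvesE ex /solvesE ey /solvesE ez.
have [exy _] := element_inj hat (etrans ex (esym ey)).
suff -> : L (x - y + z) = L z by [].
apply/ffunP => i; rewrite (affine_combination _ _ _ (hL i)).
by rewrite exy subrr add0r.
Qed.

Lemma gdefinable_definable q (V : set {ffun 'I_q -> G}) :
  definable V -> gdefinable (fun e : 'I_q -> G => V [ffun c => e c]).
Proof.
case=> p [F [m ->]].
have h : forall c, gaffine (fun e : 'I_q -> G => env_cat e m c).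
  by move=> c; rewrite /env_cat; case: split => i;
    [apply: gaffine_var | apply: gaffine_const].
apply: gdefinable_ext (gdefinable_comp h (gdefinable_holds hat F)) => e.
suff -> : [ffun c => e c] = e :> ('I_q -> G) by [].
by apply: funext => c; rewrite ffunE.
Qed.

(* Representatives are cut down by minimising one natural number at a time. *)
Lemma coset_qf_minimal (E : G -> G -> Prop) (I : eqType)
    (kappa : I -> G -> nat) (s : seq I) :
  (forall g, E g g) -> (forall g h, E g h -> E h g) ->
  (forall g h l, E g h -> E h l -> E g l) ->
  gdefinable (fun e : 'I_2 -> G => E (e (lift ord0 ord0)) (e ord0)) ->
  (forall i, gdefinable (fun e : 'I_2 -> G =>
     kappa i (e (lift ord0 ord0)) <= kappa i (e ord0))%N) ->
  exists R : set G, [/\ coset_qf R, forall g, exists r, R r /\ E r g &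
    forall r r', R r -> R r' -> E r r' ->
    forall i, i \in s -> kappa i r = kappa i r'].
Proof.
move=> refl sym trans hE hk; elim: s => [|i s [R [hR ex uniq]]].
  exists setT; split=> // [j|g]; first exact: qf_const.
  by exists g.
pose R' g := R g /\ forall h, R h -> E g h -> (kappa i g <= kappa i h)%N.
exists R'; split=> [|g|r r' [Rr mr] [Rr' mr'] rr' i'] //=.
(* Variable 0 is the quantified competitor and variable 1 the candidate for minimality. *)
- pose W (e : 'I_2 -> G) := R (e ord0) -> E (e (lift ord0 ord0)) (e ord0) ->
    (kappa i (e (lift ord0 ord0)) <= kappa i (e ord0))%N.
  have hW : gdefinable W.
    apply: gdefinable_imp; first exact: gdefinable_unary (gaffine_var _ _ _).
    exact: gdefinable_imp.
  have hR1 : gdefinable (fun e : 'I_1 -> G => R (e ord0)).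
    exact: gdefinable_unary (gaffine_var _ _ _).
  have := coset_qf_gdefinable (gdefinable_and hR1 (gdefinable_all hat hW)).
  congr coset_qf; apply: funext => g.
  by rewrite /R' /W /env_cons unlift_none liftK.
- have [r0 [Rr0 r0g]] := ex g.
  have hP : exists n, `[< exists r, [/\ R r, E r g & kappa i r = n] >].
    by exists (kappa i r0); apply/asboolP; exists r0.
  case: (ex_minnP hP) => n /asboolP[r [Rr rg rn]] min.
  exists r; split=> //; split=> // h Rh rh; rewrite rn; apply: min.
  by apply/asboolP; exists h; split=> //; apply: trans (sym _ _ rh) rg.
rewrite inE => /orP[/eqP->|]; last exact: uniq.
by apply/eqP; rewrite eqn_leq mr // mr' //; apply: sym.
Qed.

(** The coset index together with the absolute values and signs of the coordinates determines an
    element, so minimising all of these numbers in turn leaves exactly one element in each class. *)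
Lemma coset_qf_representatives (E : G -> G -> Prop) :
  (forall g, E g g) -> (forall g h, E g h -> E h g) ->
  (forall g h l, E g h -> E h l -> E g l) ->
  gdefinable (fun e : 'I_2 -> G => E (e (lift ord0 ord0)) (e ord0)) ->
  exists R : set G, coset_qf R /\ forall g, exists! r, R r /\ E r g.
Proof.
move=> refl sym trans hE.
have /choice[zj zjE] (g : G) : exists zj, g = element zj.1 zj.2.
  by have [z [j ->]] := elementP hat g; exists (z, j).
have zjK z j : zj (element z j) = (z, j).
  have [e1 e2] := element_inj hat (zjE (element z j)).
  by rewrite [LHS]surjective_pairing -e1 -e2.
pose kappa (u : unit + ('I_k + 'I_k)) (g : G) : nat := match u with
  | inl _ => enum_rank (zj g).2
  | inr (inl i) => absz ((zj g).1 i)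
  | inr (inr i) => (zj g).1 i < 0
  end.
have hk u : gdefinable (fun e : 'I_2 -> G =>
    kappa u (e (lift ord0 ord0)) <= kappa u (e ord0))%N.
  move=> f; case: u => [[]|[i|i]]; rewrite /kappa.
  - apply: qf_ext (qf_const _ (enum_rank (f (lift ord0 ord0)) <=
                               enum_rank (f ord0))%N) => x.
    by rewrite /environment !zjK.
  - pose u (x : {ffun 'I_2 * 'I_k -> int}) := x (lift ord0 ord0, i).
    pose v (x : {ffun 'I_2 * 'I_k -> int}) := x (ord0, i).
    have hu : affine u by apply: affine_var.
    have hv : affine v by apply: affine_var.
    (* Comparison of absolute values, written with affine inequalities only: both [u] and [- u] are
       at most [v] or [- v]. *)
    have h : qf (fun x => (u x <= v x \/ u x <= - v x) /\
                          (- u x <= v x \/ - u x <= - v x)).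
      by apply: qf_and; apply: qf_or; apply: qf_le => //; apply: affine_opp.
    apply: qf_ext h => x; rewrite /environment !zjK !ffunE /u /v.
    move: (x _) (x _) => p q; split=> [[[h|h] [h'|h']]|h]; lia.
  - have h : qf (fun x : {ffun 'I_2 * 'I_k -> int} =>
        0 <= x (ord0, i) -> 0 <= x (lift ord0 ord0, i)).
      by apply: qf_imp; apply: qf_ge; apply: affine_var.
    apply: qf_ext h => x; rewrite /environment !zjK !ffunE.
    move: (x _) (x _) => p q; split=> [|h]; [case: (leP 0 p) |]; lia.
have [R [hR ex uniq]] :=
  coset_qf_minimal (enum {: unit + ('I_k + 'I_k)}) refl sym trans hE hk.
exists R; split=> // g; have [r [Rr rg]] := ex g; exists r; split=> // r' [Rr' r'g].
have {}uniq u : kappa u r = kappa u r'.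
  by apply: uniq; rewrite ?mem_enum ?inE //; apply: trans rg (sym _ _ r'g).
rewrite (zjE r) (zjE r'); congr element.
  apply/ffunP => i; move: (uniq (inr (inl i))) (uniq (inr (inr i))).
  by rewrite /kappa; move: ((zj r).1 i) ((zj r').1 i) => p q; lia.
by have /ord_inj/enum_rank_inj := uniq (inl tt).
Qed.

Lemma gdefinable_subgroup (Q : finType) (F : (Q -> G) -> G) (H : set G) :
  is_subgroup H -> gaffine F -> gdefinable (fun e => H (F e)).
Proof. by move=> hH hF; apply: gdefinable_unary => //; apply: coset_qf_subgroup. Qed.

Lemma right_coset_representatives (H : set G) : is_subgroup H ->
  exists R : set G, right_coset_reps H R /\ coset_qf R.
Proof.
move=> hH; have [H1 HM HV] := hH.
have [g|g h gh|g h l gh hl||R [hR ex]] :=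
  @coset_qf_representatives (fun r g => H (r * g^-1)%g).
- by rewrite mulgV.
- by have := HV _ gh; rewrite invgM invgK.
- by have := HM _ _ gh hl; rewrite mulgA mulgVK.
- apply: gdefinable_subgroup => //; apply: gaffine_mul => //.
    exact: gaffine_var.
  by apply: gaffine_inv => //; apply: gaffine_var.
- by exists R.
Qed.

Lemma left_coset_representatives (H : set G) : is_subgroup H ->
  exists R : set G, left_coset_reps H R /\ coset_qf R.
Proof.
move=> hH; have [H1 HM HV] := hH.
have [g|g h gh|g h l gh hl||R [hR ex]] :=
  @coset_qf_representatives (fun r g => H (g^-1 * r)%g).
- by rewrite mulVg.
- by have := HV _ gh; rewrite invgM invgK.
- by have := HM _ _ hl gh; rewrite -mulgA mulVKg.
- apply: gdefinable_subgroup => //; apply: gaffine_mul => //.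
    by apply: gaffine_inv => //; apply: gaffine_var.
  exact: gaffine_var.
- by exists R.
Qed.

Lemma conjugacy_representatives :
  exists R : set G, conjugacy_reps R /\ coset_qf R.
Proof.
have [g|g h [l ->]|g h l [u ->] [v ->]||R [hR ex]] :=
  @coset_qf_representatives (fun r g => exists h, r = (g ^ h)%g).
- by exists 1%g; rewrite conjg1.
- by exists l^-1%g; rewrite conjgK.
- by exists (v * u)%g; rewrite conjgM.
(* Variable 0 is the conjugating element, bound by the quantifier, which shifts the other two by
   one. *)
- pose W (e : 'I_3 -> G) := e (lift ord0 (lift ord0 ord0)) =
    ((e ord0)^-1 * (e (lift ord0 ord0) * e ord0))%g.
  have hW : gdefinable W.
    apply: gdefinable_eq => //; first exact: gaffine_var.
    apply: gaffine_mul => //.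
      by apply: gaffine_inv => //; apply: gaffine_var.
    by apply: gaffine_mul => //; apply: gaffine_var.
  apply: gdefinable_ext (gdefinable_ex hat hW) => e.
  by rewrite /W /env_cons unlift_none !liftK.
- by exists R.
Qed.

End Representatives.

(** * Direct powers of the group *)

Section Powers.
Variables (G : groupType) (k : nat) (a : 'I_k -> G) (J : finType) (t : J -> G).
Hypothesis hat : natural_generators a t.
Variable q : nat.

Lemma pow_index_bij : bijective (@pow_index q k).
Proof.
rewrite /pow_index; set e := esym _.
exists (fun y => cast_ord (esym e) (enum_rank y)) => [i|y].
  by rewrite enum_valK cast_ordK.
by rewrite cast_ordKV enum_rankK.
Qed.

Lemma zexpg_ffun (f : {ffun 'I_q -> G}) n c : zexpg f n c = zexpg (f c) n.
Proof.
have hX m : (f ^+ m)%g c = (f c ^+ m)%g.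
  by elim: m => [|m IH]; rewrite ?expg0 ?ffunE // !expgS ffunE IH.
by case: n => m /=; rewrite ?ffunE hX.
Qed.

(** Each component of a normal form in the power is a normal form in [G], whose exponents are those
    of the generators of that copy. *)
Lemma pow_elementE (index : 'I_q * 'I_k -> 'I_(q * k))
    (z : {ffun 'I_(q * k) -> int}) (f : {ffun 'I_q -> J}) c :
  cancel (@pow_index q k) index -> cancel index (@pow_index q k) ->
  (\prod_(i < q * k) zexpg (pow_basis a i) (z i) * pow_transversal t f)%g c =
  environment a t f [ffun y => z (index y)] c.
Proof.
move=> K1 K2; rewrite ffunE /environment /element; congr (_ * _)%g; last by rewrite ffunE.
rewrite (big_morph (fun g : {ffun 'I_q -> G} => g c)
  (id1 := 1%g) (op1 := *%g)) => [|u v|]; rewrite ?ffunE //.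
(* The vector that the generator numbered [i] contributes to component [c]; it is zero when the
   generator belongs to another copy. *)
pose phi i : {ffun 'I_k -> int} :=
  [ffun i' => if (c, i') == pow_index i then z i else 0].
have phiE i : zexpg (pow_basis a i) (z i) c = lattice a (phi i).
  rewrite zexpg_ffun ffunE /phi; case: (pow_index i) => c' i' /=.
  rewrite /lattice; case: eqP => [->|cc'].
    rewrite (@big_only1 _ _ _ _ i') // => [|i2 /negPf i2i _].
      by rewrite ffunE eqxx.
    by rewrite ffunE xpair_eqE i2i andbF.
  rewrite big1 => [|i2 _]; last by rewrite ffunE xpair_eqE; case: eqP.
  by case: (z i) => m /=; rewrite expg1n ?invg1.
under eq_bigr do rewrite phiE.
rewrite -(big_morph _ (latticeD hat) (lattice0 a)); congr lattice.
apply/ffunP => i'; rewrite sum_ffunE ffunE (bigD1 (index (c, i'))) //= ffunE.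
rewrite K2 eqxx big1 ?addr0 ?ffunE // => i ii.
rewrite ffunE; case: eqP => // e; case/eqP: ii.
by rewrite e K1.
Qed.

Lemma gdefinable_n_regular_EDT0L_NF (V : set {ffun 'I_q -> G}) :
  gdefinable a t (fun e : 'I_q -> G => V [ffun c => e c]) ->
  n_regular_EDT0L_NF (pow_basis (q:=q) a) (pow_transversal (q:=q) t) V.
Proof.
move=> hV; have [index K1 K2] := pow_index_bij.
apply: qf_n_regular_EDT0L_NF => f.
have hh y : affine (fun z : {ffun 'I_(q * k) -> int} =>
    ([ffun y => z (index y)] : {ffun 'I_q * 'I_k -> int}) y).
  by apply: affine_ext (affine_var (index y)) => z; rewrite ffunE.
apply: qf_ext (qf_comp hh (hV f)) => z.
set u := finfun _; set v := (_ * _)%g; suff -> : u = v by [].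
by apply/ffunP => c; rewrite ffunE (pow_elementE z f c K1 K2).
Qed.

End Powers.

Theorem theorem1p4 (G : groupType) (k d : nat) (a : 'I_k -> G) (t : 'I_d -> G)
    (hat : natural_generators a t) :
  (forall (S : finType) (s : S -> G),
     generated (range s) = setT ->
     forall U : set G, rational s U -> n_regular_EDT0L_NF a t U) /\
  (forall H : set G, is_subgroup H -> n_regular_EDT0L_NF a t H) /\
  (forall H : set G, is_subgroup H ->
     (exists R : set G, right_coset_reps H R /\ n_regular_EDT0L_NF a t R) /\
     (exists R : set G, left_coset_reps H R /\ n_regular_EDT0L_NF a t R)) /\
  (forall (q : nat) (V : set {ffun 'I_q -> G}), algebraic V ->
     n_regular_EDT0L_NF (pow_basis (q:=q) a) (pow_transversal (q:=q) t) V) /\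
  (forall (q : nat) (V : set {ffun 'I_q -> G}), definable V ->
     n_regular_EDT0L_NF (pow_basis (q:=q) a) (pow_transversal (q:=q) t) V) /\
  (exists R : set G, conjugacy_reps R /\ n_regular_EDT0L_NF a t R).
Proof.
have NF (U : set G) : coset_qf a t U -> n_regular_EDT0L_NF a t U.
  exact: qf_n_regular_EDT0L_NF.
split; [|split; [|split; [|split; [|split]]]].
- by move=> S s _ U hU; apply/NF/(coset_qf_rational hat hU).
- by move=> H hH; apply/NF/coset_qf_subgroup.
- move=> H hH; split.
    have [R [hR /NF ?]] := right_coset_representatives hat hH; by exists R.
  have [R [hR /NF ?]] := left_coset_representatives hat hH; by exists R.
- move=> q V hV; apply: gdefinable_n_regular_EDT0L_NF => //.
  exact: gdefinable_algebraic.
- move=> q V hV; apply: gdefinable_n_regular_EDT0L_NF => //.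
  exact: gdefinable_definable.
- have [R [hR /NF ?]] := conjugacy_representatives hat; by exists R.
Qed.
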